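(* Let $K=K(n)$ be a positive integer. Consider the following controlled random graph process on vertex set $[n]=\{1,\dots,n\}$: start with the empty graph $B_0$ on $[n]$; at each round $i=1,2,\dots$, a set of $K$ edges is presented, chosen uniformly at random from the edges of $K_n$ not present in the current graph $B_{i-1}$, and one may choose at most one of the presented edges and add it to the current graph, immediately and irrevocably, yielding $B_i$. Let $$t=\Big(1+\frac{250}{\log\log n}\Big)\Big(0.5+\frac{\log n}{2K}\Big)n,\qquad b=\Big(0.5+\frac{11}{\log\log n}\Big)n.$$ Then there exists a (possibly adaptive, online) strategy for choosing edges such that, with probability $1-o(1)$ as $n\to\infty$, the graph $B_t$ constructed within the first $t$ rounds has at most $b$ edges and contains a matching of size $\lfloor n/2\rfloor$.
   Context: Here $\log$ denotes the natural logarithm. A strategy decides at each round, based on the history so far, which (if any) of the $K$ presented edges to add. ''With high probability'' means with probability tending to $1$ as $n\to\infty$. *)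

(* Defs.v *)
From HB Require Import structures.
From mathcomp Require Import all_boot all_order all_algebra.
From mathcomp Require Import all_classical all_reals all_analysis.

Set Implicit Arguments.
Unset Strict Implicit.
Unset Printing Implicit Defensive.

Import Order.TTheory GRing.Theory Num.Theory.
Import numFieldNormedType.Exports.

Local Open Scope ring_scope.

Definition edge (n : nat) := {set 'I_n}.
Definition graph (n : nat) := {set {set 'I_n}}.

Definition complete_graph (n : nat) : graph n := [set e : {set 'I_n} | #|e| == 2%N].

Definition missing (n : nat) (B : graph n) : graph n := complete_graph n :\: B.

(* Once fewer than [K] edges are missing, a set of [K] missing edges does not
   exist; the process is then continued by presenting all the missing edges,
   so that there is always at least one possible offer (maybe the empty one). *)
Definition offers (n K : nat) (B : graph n) : {set graph n} :=
  [set X : graph n | (X \subset missing B) & (#|X| == minn K #|missing B|)].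

(* The past rounds, oldest first: the presented set and the decision taken. *)
Definition history (n : nat) := seq (graph n * option (edge n)).

(* The graph B_i depends on the history only: the initial graph is empty and
   an edge is added exactly when it is chosen. *)
Definition built (n : nat) (h : history n) : graph n :=
  [set e : {set 'I_n} | Some e \in [seq r.2 | r <- h]].

Definition strategy (n : nat) := history n -> graph n -> option (edge n).

Definition legal (n : nat) (S : strategy n) : Prop :=
  forall (h : history n) (X : graph n) (e : edge n), S h X = Some e -> e \in X.

Definition play (n : nat) (S : strategy n) (h : history n) (X : graph n) :
  history n := rcons h (X, S h X).

Definition run (n : nat) (S : strategy n) (w : seq (graph n)) : history n :=
  foldl (play S) [::] w.

Definition offer_prob (R : realType) (n K : nat) (B X : graph n) : R :=
  if X \in offers K B then #|offers K B|%:R^-1 else 0.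

(* Probability that, after the history [h], the next presented sets are the
   elements of [w], in this order: product of the conditional probabilities. *)
Fixpoint offers_prob (R : realType) (n K : nat) (S : strategy n)
    (h : history n) (w : seq (graph n)) : R :=
  if w is X :: w' then
    offer_prob R K (built h) X * offers_prob R K S (play S h X) w'
  else 1.

Definition process_prob (R : realType) (n K : nat) (S : strategy n) (m : nat)
    (E : pred (graph n)) : R :=
  \sum_(w : m.-tuple (graph n) | E (built (run S w))) offers_prob R K S [::] w.

Definition has_matching (n : nat) (B : graph n) (s : nat) : bool :=
  [exists M : graph n, [&& M \subset B, finset.trivIset M & #|M| == s]].

(* Real numbers; only large [n] matter, since [ln (ln n)] is nonpositive or a
   default value for small [n]. *)
Definition rounds (R : realType) (n K : nat) : R :=
  (1 + 250 / ln (ln n%:R)) * (1 / 2 + ln n%:R / (2 * K%:R)) * n%:R.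

Definition budget (R : realType) (n : nat) : R :=
  (1 / 2 + 11 / ln (ln n%:R)) * n%:R.

Lemma card_offers_gt0 (n K : nat) (B : graph n) : (0 < #|offers K B|)%N.
Proof.
rewrite /offers cards_draws bin_gt0; exact: geq_minr.
Qed.

Lemma offer_prob_sum (R : realType) (n K : nat) (B : graph n) :
  \sum_(X : graph n) offer_prob R K B X = 1.
Proof.
rewrite /offer_prob -big_mkcond sumr_const -[LHS]mulr_natr mulVf //.
by rewrite pnatr_eq0 -lt0n card_offers_gt0.
Qed.

Lemma offers_prob_sum (R : realType) (n K : nat) (S : strategy n)
    (h : history n) (m : nat) :
  \sum_(w : m.-tuple (graph n)) offers_prob R K S h w = 1.
Proof.
elim: m h => [|m IH] h.
  by rewrite (big_pred1 [tuple]) // => w; apply/esym/eqP; exact: tuple0.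
pose f (p : graph n * m.-tuple (graph n)) : m.+1.-tuple (graph n) :=
  [tuple of p.1 :: p.2].
rewrite (reindex f) /=; last first.
  exists (fun w => (thead w, [tuple of behead w])) => [[X w]|w] _.
    by rewrite /f /= theadE; congr pair; apply: val_inj.
  by rewrite /f -tuple_eta.
rewrite -(pair_big xpredT xpredT (fun X (w : m.-tuple (graph n)) =>
  offer_prob R K (built h) X * offers_prob R K S (play S h X) w)) /=.
rewrite -[RHS](offer_prob_sum R K (built h)); apply: eq_bigr => X _.
by rewrite -mulr_sumr IH mulr1.
Qed.

Lemma process_prob_predT (R : realType) (n K : nat) (S : strategy n)
    (m : nat) :
  process_prob R K S m predT = 1.
Proof. exact: offers_prob_sum. Qed.

(* Main.v *)
(* The success probability of the best strategy is computed by backward induction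
   on the number of remaining rounds, so it suffices to bound from above its loss,
   choosing the edge to add as a function of the current graph. Let a = ln n and
   L = ln a. Up to small powers of s = a^(1/20):

   1. Greedily match all but n / s^18 vertices.
   2. Most unmatched vertices u collect s^8 legs u - w, where w is matched to f w,
      and an edge from another unmatched vertex to f w then augments the matching.
      This reduces the number of unmatched vertices to n / s^26, that is o(n / a).
   3. Put aside a reserve of n / s^4 matched pairs {x, f x} and add edges f x - y
      until any two disjoint sets of n / s^5 pairs are joined: a union bound over
      pairs of sets, run as a potential.
   4. During about (1 + 100 / L) a n / (2 K) + 50 n / L rounds every unmatched vertex
      collects s^9 legs. This is the only phase that costs the leading order, and
      the factor 1 + 100 / L pays for asking s^9 legs instead of one.
   5. The many ends f w of the legs of u are joined quickly to the reserve. In the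
      reserve, all but few vertices reach almost all others by alternating paths of
      length at most s^21, so unmatched vertices are augmented two by two, and the
      paths used up remain a negligible part of the reserve.

   Outside phase 4 every round either makes progress or is wasted, and the expected
   number of wasted rounds is o(a n / (K L)), so Markov's inequality suffices. *)
Require Import Defs.
From HB Require Import structures.
From mathcomp Require Import all_boot all_order all_algebra.
From mathcomp Require Import all_classical all_reals all_analysis.
From mathcomp Require Import ring lra zify perm.
Set Implicit Arguments.
Unset Strict Implicit.
Unset Printing Implicit Defensive.
Import Order.TTheory GRing.Theory Num.Theory.
Import numFieldNormedType.Exports.
Import mathcomp.boot.fintype mathcomp.boot.finset.
Local Open Scope ring_scope.

(** * Optimal strategies *)

(** The exponents come from one account. A step that needs one of [e] edges wastes at most
    [n^2 / (2 K e)] rounds on average. In each phase these waits must sum to at most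
    [3 (n / K) s^18]: a budget of [3 (n / K) s^19] wasted rounds then fails with probability at most
    [1 / s], and it is negligible because [s^20] is about [a], while [L <= s]. Greedy matching alone
    must therefore stop near [n / s^18] unmatched vertices. Legs multiply the number of useful
    edges, which is what allows going lower. The target [n / s^26] is dictated by phase 4: when [K]
    is large, its bound costs about [a m] rounds for [m] unmatched vertices. Serving the very last
    vertex costs a factor [a], as for a coupon collector, and this factor may be paid in full only
    once. Phase 5 has a harmonic sum of its own. With one leg per vertex and reserve sets of size
    [n / s^5] it would waste about [s^5 a n / K] rounds; with [s^9] legs it stays within the budget.
    Asking for so many legs in phase 4 is almost free, since it enters only through the logarithm of
    an exponential moment. *)

Lemma bin_miss_bound (M e K : nat) :
  ('C(M - e, K) * (M + K * e) <= M * 'C(M, K))%N.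
Proof.
elim: K => [|K IH]; first by rewrite !bin0 mul0n addn0 mul1n muln1.
rewrite -(leq_pmul2l (ltn0Sn K)).
(* When [M - e <= K] the left factor is 0, so the truncated subtraction does no harm. *)
have step : ((M - e - K) * (M + K.+1 * e) <= (M - K) * (M + K * e))%N.
  have [h|h] := leqP (M - e) K; first by have/eqP-> : (M - e - K == 0)%N by rewrite subn_eq0.
  have -> : (M - e - K = M - K - e)%N by lia.
  have h2 : (K + e <= M)%N by lia.
  rewrite -(subnK h2); nia.
have -> : (K.+1 * ('C(M - e, K.+1) * (M + K.+1 * e)) =
           (M - e - K) * (M + K.+1 * e) * 'C(M - e, K))%N.
  by rewrite mulnA mul_bin_left mulnAC.
have -> : (K.+1 * (M * 'C(M, K.+1)) = (M - K) * (M * 'C(M, K)))%N.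
  by rewrite mulnCA mul_bin_left mulnCA.
apply: leq_trans (leq_mul step (leqnn _)) _.
by rewrite -mulnA leq_mul2l [X in (X <= _)%N]mulnC IH orbT.
Qed.

Lemma card_disjoint_draws (T : finType) (M E : {set T}) (k : nat) : E \subset M ->
  #|[set X : {set T} | (X \subset M) && (#|X| == k) & [disjoint X & E]]|
  = 'C(#|M| - #|E|, k).
Proof.
move=> EM; rewrite -cardsDS // -cards_draws; apply: eq_card => X.
rewrite !inE subsetD; by case: (X \subset M); case: (#|X| == k); case: [disjoint _ & _].
Qed.

(* By symmetry under the transposition of two elements of [E]. *)
Lemma hit_weight_symmetric (R : realType) (T : finType) (M E : {set T}) (k : nat) (e e' : T) :
  E \subset M -> e \in E -> e' \in E ->
  \sum_(X : {set T} | (X \subset M) && (#|X| == k) && (e \in X)) (#|X :&: E|%:R^-1 : R) =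
  \sum_(X : {set T} | (X \subset M) && (#|X| == k) && (e' \in X)) #|X :&: E|%:R^-1.
Proof.
move=> EM eE e'E; pose s := tperm e e'.
have sE (A : {set T}) : e \in A -> e' \in A -> s @: A = A.
  move=> eA e'A; apply/eqP; rewrite eqEcard card_imset ?leqnn ?andbT; last exact: perm_inj.
  by apply/fintype.subsetP => _ /imsetP[x xA ->]; rewrite /s; case: tpermP.
have sK : involutive (fun X : {set T} => s @: X).
  by move=> X; rewrite -imset_comp (eq_imset (g := id)) ?imset_id // => x /=; rewrite tpermK.
have sM (X : {set T}) : (s @: X \subset M) = (X \subset M).
  have sub (Y : {set T}) : Y \subset M -> s @: Y \subset M.
    have sMM : s @: M = M by apply: sE; exact: (fintype.subsetP EM).
    move=> YM; rewrite -sMM. exact: imsetS.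
  by apply/idP/idP => [/sub|/sub //]; rewrite sK.
rewrite (reindex_inj (inv_inj sK)); apply: eq_big => [X|X _].
  rewrite sM card_imset; last exact: perm_inj.
  congr (_ && _); rewrite -{1}(tpermR e e') mem_imset //; exact: perm_inj.
have -> : (s @: X) :&: E = s @: (X :&: E).
  by rewrite imsetI ?(sE E) // => x y _ _; apply: perm_inj.
by rewrite card_imset //; apply: perm_inj.
Qed.

Section Value.
Variables (R : realType) (n K : nat) (G : pred (graph n)).
Implicit Types (B X E : graph n) (o : option (edge n)).

Definition add_edge o B : graph n := if o is Some e then e |: B else B.

Definition allowed X o : bool := if o is Some e then e \in X else true.

(* Failure probability of the best strategy with [T] rounds left, by backward
   induction; strategies need no memory beyond the current graph. *)
Fixpoint loss (T : nat) : graph n -> R :=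
  if T is T'.+1 then fun B => \sum_(X : graph n) offer_prob R K B X *
    loss T' (add_edge [arg min_(o < None | allowed X o)
                         loss T' (add_edge o B)]%O B)
  else fun B => (~~ G B)%:R.

Definition best T B X : option (edge n) :=
  [arg min_(o < None | allowed X o) loss T (add_edge o B)]%O.

Lemma bestP T B X : allowed X (best T B X) /\
  forall o, allowed X o -> loss T (add_edge (best T B X) B) <= loss T (add_edge o B).
Proof. by rewrite /best; case: arg_minP. Qed.

Lemma offer_prob_ge0 B X : 0 <= offer_prob R K B X.
Proof. by rewrite /offer_prob; case: ifP. Qed.

Lemma lossS T B : loss T.+1 B =
  \sum_(X : graph n) offer_prob R K B X * loss T (add_edge (best T B X) B).
Proof. by []. Qed.

Lemma loss_le1 T B : loss T B <= 1.
Proof.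
elim: T B => [|T IH] B; first by rewrite /=; case: (G B).
rewrite lossS -[leRHS](offer_prob_sum R K B); apply: ler_sum => X _.
by rewrite ler_piMr ?offer_prob_ge0.
Qed.

Lemma loss_ge0 T B : 0 <= loss T B.
Proof.
elim: T B => [|T IH] B; first by rewrite /=; case: (G B).
by rewrite lossS; apply: sumr_ge0 => X _; rewrite mulr_ge0 ?offer_prob_ge0.
Qed.

Lemma loss_step T B (c : graph n -> option (edge n)) :
  (forall X, allowed X (c X)) ->
  loss T.+1 B <= \sum_(X : graph n) offer_prob R K B X * loss T (add_edge (c X) B).
Proof.
move=> cP; rewrite lossS; apply: ler_sum => X _.
by rewrite ler_wpM2l ?offer_prob_ge0 //; apply: (bestP T B X).2.
Qed.

Lemma loss_monoS T B : loss T.+1 B <= loss T B.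
Proof.
apply: le_trans (loss_step T B (c := fun=> None) _) _ => //=.
by rewrite -mulr_suml offer_prob_sum mul1r.
Qed.

Lemma loss_mono T T' B : (T <= T')%N -> loss T' B <= loss T B.
Proof.
move=> /subnK <-; elim: (_ - _)%N => [|j IH] //; rewrite addSn.
exact: le_trans (loss_monoS _ _) IH.
Qed.

(** Round [(size h).+1] is being played, so [(t - size h).-1] rounds come after it; this is the
    horizon at which [best] compares losses. *)
Definition optimal (t : nat) : strategy n :=
  fun h X => best (t - size h).-1 (built h) X.

Lemma optimal_legal t : legal (optimal t).
Proof.
by move=> h X e he; have [] := bestP (t - size h).-1 (built h) X; rewrite -/(optimal t h X) he.
Qed.

Lemma built_rcons (h : history n) X o :
  built (rcons h (X, o)) = add_edge o (built h).
Proof.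
apply/setP => e; rewrite inE map_rcons mem_rcons inE.
case: o => [e'|] /=; rewrite ?inE //.
Qed.

Lemma process_optimal t : process_prob R K (optimal t) t G = 1 - loss t set0.
Proof.
pose S := optimal t.
(* Generalised to an arbitrary past [h], which matters only through its length and [built h]. *)
suff H m (h : history n) : (size h + m = t)%N ->
  \sum_(w : m.-tuple (graph n) | G (built (foldl (play S) h w)))
     offers_prob R K S h w = 1 - loss m (built h).
  rewrite /process_prob /run (H t [::]) ?add0n //.
elim: m h => [|m IH] h hm.
  rewrite (eq_bigl (fun=> G (built h))); last by move=> w; rewrite tuple0.
  rewrite /= big_mkcond (big_pred1 [tuple]); last by move=> w; apply/esym/eqP; exact: tuple0.
  by case: (G _) => /=; rewrite ?subr0 ?subrr.
pose f (p : graph n * m.-tuple (graph n)) : m.+1.-tuple (graph n) :=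
  [tuple of p.1 :: p.2].
rewrite (reindex f) /=; last first.
  exists (fun w => (thead w, [tuple of behead w])) => [[X w]|w] _.
    by rewrite /f /= theadE; congr pair; apply: val_inj.
  by rewrite /f -tuple_eta.
rewrite -(pair_big_dep xpredT (fun X (w : m.-tuple (graph n)) => G (built (foldl (play S) (play S h X) w))) (fun X (w : m.-tuple (graph n)) =>
  offer_prob R K (built h) X * offers_prob R K S (play S h X) w)) /=.
rewrite -[in RHS](offer_prob_sum R K (built h)) -sumrB; apply: eq_bigr => X _.
rewrite -mulr_sumr IH; last by rewrite /play size_rcons addSnnS.
rewrite mulrBr mulr1 /play built_rcons /S /optimal.
by have -> : (t - size h).-1 = m by rewrite -hm addKn.
Qed.

Lemma card_missing_le B : (#|missing B| * 2 <= n * n)%N.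
Proof.
apply: (@leq_trans (#|complete_graph n| * 2)%N).
  by rewrite leq_mul2r subset_leq_card ?subsetDl.
have -> : #|complete_graph n| = 'C(n, 2).
  by rewrite -[X in 'C(X, _)](card_ord n) -card_draws; apply: eq_card => e; rewrite !inE.
rewrite bin2; apply: (@leq_trans (n * n.-1)); last by rewrite leq_mul2l leq_pred orbT.
by rewrite muln2 -[leqRHS]odd_double_half leq_addl.
Qed.

(* The best offered edge of [E] does at least as well as a uniformly chosen
   offered edge of [E], which by symmetry is uniform in [E]; [p] is the
   probability that no edge of [E] is offered. *)
Lemma one_step T B E : (0 < K)%N -> E \subset missing B -> E != set0 ->
  exists p : R, [/\ 0 <= p, p <= 1,
    p * (K * #|E|)%:R <= (1 - p) * ((n * n)%:R / 2) &
    loss T.+1 B <= p * loss T B + (1 - p) * ((\sum_(e in E) loss T (e |: B)) / #|E|%:R)].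
Proof.
move=> K0 EM E0; have /set0Pn[e0 e0E] := E0.
have Epos : 0 < #|E|%:R :> R by rewrite ltr0n card_gt0.
pose O := offers K B; pose k := minn K #|missing B|.
have OE X : (X \in O) = (X \subset missing B) && (#|X| == k) by rewrite inE.
pose miss := [set X in O | [disjoint X & E]].
pose hit := O :\: miss.
have hitE X : (X \in hit) = (X \in O) && ~~ [disjoint X & E].
  by rewrite !inE; case: (X \subset _); case: (_ == _); rewrite ?andbF ?andbT.
have O0 : 0 < #|O|%:R :> R by rewrite ltr0n card_offers_gt0.
have cO : (#|miss| + #|hit| = #|O|)%N.
  by rewrite -(cardsID miss O) (setIidPr _) //; apply/fintype.subsetP => X; rewrite inE => /andP[].
(* Each offer that meets [E] spreads one unit of weight evenly over its edges in [E]; [w e] is the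
   total that [e] receives. *)
pose w (e : edge n) : R :=
  \sum_(X : graph n | (X \subset missing B) && (#|X| == k) && (e \in X)) #|X :&: E|%:R^-1.
have wE e : e \in E -> w e = w e0 by move=> eE; apply: hit_weight_symmetric.
have avg (l : edge n -> R) :
    \sum_(X in hit) (\sum_(e in X :&: E) l e) / #|X :&: E|%:R = w e0 * \sum_(e in E) l e.
  under eq_bigr => X _ do rewrite mulr_suml.
  rewrite (exchange_big_dep (mem E)) /=; last by move=> X e _; rewrite inE => /andP[].
  rewrite mulr_sumr; apply: eq_bigr => e eE.
  rewrite -mulr_sumr mulrC -(wE e eE); congr (_ * _); apply: eq_bigl => X.
  rewrite hitE OE inE eE andbT; case eX: (e \in X); rewrite ?andbF ?andbT //.
  by rewrite (_ : ~~ [disjoint X & E]) ?andbT //; apply/pred0Pn; exists e; rewrite /= eX.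
(* The constant function 1 in [avg] gives the common weight. *)
have wval : w e0 = #|hit|%:R / #|E|%:R.
  apply: (mulIf (lt0r_neq0 Epos)); rewrite divfK ?lt0r_neq0 //.
  have := avg (fun=> 1); rewrite sumr_const => <-.
  rewrite -sum1_card natr_sum; apply: eq_bigr => X.
  rewrite hitE => /andP[_ /pred0Pn[e /andP[eX eE]]].
  rewrite sumr_const divff // pnatr_eq0 -lt0n card_gt0.
  by apply/set0Pn; exists e; rewrite inE; apply/andP.
exists (#|miss|%:R / #|O|%:R).
have cOR : #|O|%:R = #|miss|%:R + #|hit|%:R :> R by rewrite -natrD cO.
have q : 1 - #|miss|%:R / #|O|%:R = #|hit|%:R / #|O|%:R :> R.
  by rewrite cOR; field; rewrite -cOR lt0r_neq0.
split.
- by rewrite divr_ge0.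
- by rewrite -subr_ge0 q divr_ge0.
- rewrite q mulrAC ler_pdivrMr // mulrAC divfK ?lt0r_neq0 //.
  have missE : #|miss| = 'C(#|missing B| - #|E|, k).
    rewrite -card_disjoint_draws //; apply: eq_card => X.
    by rewrite [LHS]inE OE inE.
  (* The odds form of the bound: unlike a linear estimate, it remains useful when [K * #|E|] exceeds
     the number of missing edges. *)
  have Ole : (#|miss| * (K * #|E|) <= #|missing B| * #|hit|)%N.
    have [KM|MK] := leqP K #|missing B|.
      have := bin_miss_bound #|missing B| #|E| K.
      have -> : 'C(#|missing B|, K) = #|O| by rewrite cards_draws (minn_idPl KM).
      rewrite missE /k (minn_idPl KM) in cO *; rewrite -cO; lia.
    (* Fewer than [K] edges are missing, so all of them are offered and [E] cannot be missed. *)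
    rewrite missE /k (minn_idPr (ltnW MK)) bin_small ?mul0n //.
    by rewrite ltn_subrL !card_gt0 E0 (subset_neq0 EM).
  have := card_missing_le B; move: Ole.
  rewrite -!(ler_nat R) !natrM => h1 h2.
  apply: le_trans h1 _; rewrite mulrC ler_wpM2l // ler_pdivlMr //.
- rewrite lossS q.
  have -> : \sum_X offer_prob R K B X * loss T (add_edge (best T B X) B) =
      #|O|%:R^-1 * \sum_(X in O) loss T (add_edge (best T B X) B).
    rewrite mulr_sumr [RHS]big_mkcond; apply: eq_bigr => X _.
    by rewrite /offer_prob -/O; case: ifP => _; rewrite ?mul0r.
  rewrite (bigID (fun X => [disjoint X & E])) /= mulrDr; apply: lerD.
    rewrite mulrC mulrAC ler_wpM2r ?invr_ge0 //.
    rewrite mulr_natl -sumr_const; under [leRHS]eq_bigl => X do rewrite inE.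
    by apply: ler_sum => X _; apply: (bestP T B X).2 None _.
  have -> : #|hit|%:R / #|O|%:R * ((\sum_(e in E) loss T (e |: B)) / #|E|%:R) =
      #|O|%:R^-1 * (#|hit|%:R / #|E|%:R * \sum_(e in E) loss T (e |: B)) by ring.
  rewrite -wval -avg ler_wpM2l ?invr_ge0 //.
  under eq_bigl => X do rewrite -hitE.
  apply: ler_sum => X; rewrite hitE => /andP[_ /pred0Pn[e /andP[eX eE]]].
  have XE : 0 < #|X :&: E|%:R :> R.
    by rewrite ltr0n card_gt0; apply/set0Pn; exists e; rewrite inE; apply/andP.
  rewrite ler_pdivlMr // mulr_natr -sumr_const; apply: ler_sum => e'.
  by rewrite inE => /andP[e'X _]; apply: (bestP T B X).2 (Some e') _.
Qed.

End Value.

(** * Phases of repeated progress *)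

Section Phases.
Variables (R : realType) (n K : nat) (G : pred (graph n)).
Hypothesis K_gt0 : (0 < K)%N.
Implicit Types (B X E : graph n).
Notation loss := (loss R K G).

(* [A c] bounds the expected number of rounds without progress when [c] steps
   remain, so more than [F] of them have probability at most [A c / F.+1]; the
   potential [W] absorbs the remaining ways to fail and must be a supermartingale
   along the steps. *)
Lemma potential_phase (P : nat -> graph n -> Prop) (W : nat -> graph n -> R)
    (A : nat -> R) (T0 : nat) (eps : R) :
  0 <= eps -> (forall c, 0 <= A c) -> (forall c, A c <= A c.+1) ->
  (forall c B, P c B -> 0 <= W c B) ->
  (forall c B, P c B -> [\/ loss T0 B <= eps + W c B,
     exists2 c', c = c'.+1 & P c' B /\ W c' B <= W c B |
     exists c' E, [/\ c = c'.+1, E \subset missing B, E != set0,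
       forall e, e \in E -> P c' (e |: B) &
       \sum_(e in E) W c' (e |: B) <= #|E|%:R * W c B /\
       (n * n)%:R / 2 <= (K * #|E|)%:R * (A c - A c')]]) ->
  forall c F B, P c B -> loss (T0 + c + F) B <= eps + W c B + A c / F.+1%:R.
Proof.
move=> eps0 A0 Amono W0 step c F0 B PB.
have D0 : 0 < F0.+1%:R :> R by rewrite ltr0n.
have incr (a : R) m : (a + m%:R) / F0.+1%:R + F0.+1%:R^-1 = (a + m.+1%:R) / F0.+1%:R.
  by rewrite -[m.+1%:R]natr1; ring.
(* [F] counts the failures still allowed; the [F0 - F] failures already spent are added to the
   expected ones, as in Markov's inequality. [N] is fuel, because either [c1] or [F] drops. *)
suff H N c1 F B1 : (c1 + F <= N)%N -> (F <= F0)%N -> P c1 B1 ->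
    loss (T0 + c1 + F) B1 <= eps + W c1 B1 + (A c1 + (F0 - F)%:R) / F0.+1%:R.
  by have := H (c + F0)%N c F0 B (leqnn _) (leqnn _) PB; rewrite subnn addr0.
elim: N c1 F B1 => [|N IH] {c B PB} c F B cFN FF0 PB.
  have [h|[c' cE _]|[c' [E [cE _ _ _ _]]]] := step c B PB; try by rewrite cE in cFN.
  apply: le_trans (loss_mono _ _ _ _ _ : _ <= loss T0 B) _; first by rewrite -addnA leq_addr.
  by apply: le_trans h _; rewrite lerDl divr_ge0 ?addr_ge0.
have [h|[c' cE [PB' WB]]|[c' [E [cE EM E0 PE [WE AE]]]]] := step c B PB.
- apply: le_trans (loss_mono _ _ _ _ _ : _ <= loss T0 B) _; first by rewrite -addnA leq_addr.
  by apply: le_trans h _; rewrite lerDl divr_ge0 ?addr_ge0.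
- subst c; apply: le_trans (loss_mono _ _ _ _ _ : _ <= loss (T0 + c' + F) B) _.
    by rewrite addnS.
  apply: le_trans (IH _ _ _ _ FF0 PB') _; first by rewrite addSn in cFN.
  apply: lerD; first by rewrite lerD2l.
  by rewrite ler_pM2r ?invr_gt0 // lerD2r.
- subst c; rewrite addnS addSn.
  have [p [p0 p1 pE hl]] := @one_step R n K G (T0 + c' + F) B E K_gt0 EM E0.
  apply: le_trans hl _.
  set X := eps + W c'.+1 B + (A c'.+1 + (F0 - F)%:R) / F0.+1%:R.
  set f := A c'.+1 - A c'.
  have miss : loss (T0 + c' + F) B <= X + F0.+1%:R^-1.
    (* With no failure left, one more miss brings the Markov term to at least 1 and the claim is
       trivial. *)
    case: F cFN FF0 @X => [|F] cFN FF0 X.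
      apply: le_trans (loss_le1 _ _ _ _ _) _.
      rewrite /X subn0 -addrA incr.
      rewrite -[leLHS]add0r; apply: lerD; first by rewrite addr_ge0 // W0.
      by rewrite ler_pdivlMr // mul1r lerDr.
    rewrite addnS -addSn -addnS.
    apply: le_trans (IH _ _ _ _ (ltnW FF0) PB) _; first by rewrite -ltnS -addnS.
    rewrite /X -[in leRHS]addrA incr.
    by rewrite subnSK.
  have hit : (\sum_(e in E) loss (T0 + c' + F) (e |: B)) / #|E|%:R <= X - f / F0.+1%:R.
    have E_gt0 : 0 < #|E|%:R :> R by rewrite ltr0n card_gt0.
    rewrite ler_pdivrMr //.
    apply: le_trans (_ : _ <= \sum_(e in E) (eps + W c' (e |: B) + (A c' + (F0 - F)%:R) / F0.+1%:R)) _.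
      by apply: ler_sum => e eE; apply: IH => //; apply: PE.
    rewrite big_split big_split /= !sumr_const.
    rewrite -(mulr_natr eps) -(mulr_natr ((A c' + _) / _)).
    have -> : (X - f / F0.+1%:R) * #|E|%:R = eps * #|E|%:R + #|E|%:R * W c'.+1 B
        + (A c' + (F0 - F)%:R) / F0.+1%:R * #|E|%:R.
      by rewrite /X /f; move: (F0.+1%:R^-1) (#|E|%:R) ((F0 - F)%:R) => x y z; ring.
    by rewrite lerD2r lerD2l.
  (* [p / (1 - p)] is the mean number of misses before a hit; the drop [f] of [A] pays for it. *)
  have pf : p <= (1 - p) * f.
    have KE : 0 < (K * #|E|)%:R :> R by rewrite ltr0n muln_gt0 K_gt0 card_gt0.
    rewrite -(ler_pM2r KE); apply: le_trans pE _.
    by rewrite -mulrA ler_wpM2l ?subr_ge0 // [leRHS]mulrC.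
  apply: le_trans (_ : _ <= p * (X + F0.+1%:R^-1) + (1 - p) * (X - f / F0.+1%:R)) _.
    by apply: lerD; apply: ler_wpM2l; rewrite ?subr_ge0.
  have -> : p * (X + F0.+1%:R^-1) + (1 - p) * (X - f / F0.+1%:R) =
     X - ((1 - p) * f - p) / F0.+1%:R by ring.
  by rewrite gerBl divr_ge0 // subr_ge0.
Qed.

(** [E] may contain edges that are already present. Adding such an edge changes nothing, so the step
    is free; otherwise all of [E] is missing and [potential_phase] applies with [W] equal to 0. *)
Lemma greedy_phase (P : nat -> graph n -> Prop)
    (A : nat -> R) (T0 : nat) (eps : R) :
  0 <= eps -> (forall c, 0 <= A c) -> (forall c, A c <= A c.+1) ->
  (forall c B, P c B -> loss T0 B <= eps \/
     exists c' E, [/\ c = c'.+1, E \subset complete_graph n, E != set0,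
       forall e, e \in E -> P c' (e |: B) &
       (n * n)%:R / 2 <= (K * #|E|)%:R * (A c - A c')]) ->
  forall c F B, P c B -> loss (T0 + c + F) B <= eps + A c / F.+1%:R.
Proof.
move=> eps0 A0 Am step c F B PB.
have := @potential_phase P (fun _ _ => 0) A T0 eps eps0 A0 Am (fun _ _ _ => lexx 0) _ c F B PB.
rewrite addr0; apply=> {PB} c1 {}B PB.
have [h|[c' [E [cE EK E0 PE AE]]]] := step c1 B PB; first by constructor 1 => /=; rewrite ?addr0.
subst c1; have [EB|[e]] := set_0Vmem (E :&: B); last first.
  rewrite inE => /andP[eE eB]; constructor 2; exists c' => //; split=> //.
  by have := PE e eE; rewrite (setUidPr _) // sub1set.
constructor 3; exists c', E; split=> //.
  rewrite subsetD EK -setI_eq0 EB eqxx //.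
by rewrite mulr0 big1.
Qed.

End Phases.

(** * Partial matchings as involutions *)

Section Matchings.
Variable n : nat.
Implicit Types (B : graph n) (f : 'I_n -> 'I_n) (X Y U : {set 'I_n}).

Definition pair_edges X Y : graph n := [set [set p.1; p.2] | p in setX X Y].

Lemma pair_edges_inj X Y : [disjoint X & Y] ->
  {in setX X Y &, injective (fun p : 'I_n * 'I_n => [set p.1; p.2])}.
Proof.
move=> dXY [x y] [x' y'] /setXP[/= xX yY] /setXP[/= x'X y'Y] /setP eq_e.
have neq a b : a \in X -> b \in Y -> a != b.
  by move=> aX bY; apply: contraTneq bY => <-; rewrite (disjointFr dXY aX).
have := eq_e x; rewrite !inE eqxx (negPf (neq _ _ xX y'Y)) orbF /= => /esym/eqP ->.
have := eq_e y; rewrite !inE eqxx orbT eq_sym (negPf (neq _ _ x'X yY)) /= => /esym/eqP ->.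
by [].
Qed.

Lemma card_pair_edges X Y : [disjoint X & Y] -> #|pair_edges X Y| = (#|X| * #|Y|)%N.
Proof. by move=> dXY; rewrite card_in_imset ?cardsX //; apply: pair_edges_inj. Qed.

Lemma pair_edgesP X Y e :
  reflect (exists x y, [/\ x \in X, y \in Y & e = [set x; y]]) (e \in pair_edges X Y).
Proof.
apply: (iffP imsetP) => [[[x y] /setXP[xX yY] ->]|[x [y [xX yY ->]]]].
  by exists x, y.
by exists (x, y); rewrite ?inE ?xX.
Qed.

Lemma sum_pair_edges (R : realType) X Y (g : edge n -> R) : [disjoint X & Y] ->
  \sum_(e in pair_edges X Y) g e = \sum_(x in X) \sum_(y in Y) g [set x; y].
Proof.
move=> dXY; rewrite big_imset /=; last exact: pair_edges_inj.
by rewrite pair_big /=; apply: eq_bigl => -[x y]; rewrite inE.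
Qed.

Lemma pair_edges_complete X Y : [disjoint X & Y] -> pair_edges X Y \subset complete_graph n.
Proof.
move=> dXY; apply/fintype.subsetP => e /pair_edgesP[x [y [xX yY ->]]].
rewrite inE cards2; case: (eqVneq x y) => // xy; by rewrite -xy (disjointFr dXY xX) in yY.
Qed.

Lemma pair_edges_neq0 X Y : (0 < #|X|)%N -> (0 < #|Y|)%N -> pair_edges X Y != finset.set0.
Proof.
rewrite !card_gt0 => /set0Pn[x xX] /set0Pn[y yY]; apply/set0Pn; exists [set x; y].
by apply/pair_edgesP; exists x, y.
Qed.

Lemma exists_subset_card (T : finType) (A : {set T}) k : (k <= #|A|)%N ->
  exists2 X : {set T}, X \subset A & #|X| = k.
Proof.
rewrite -bin_gt0 -cards_draws card_gt0 => /set0Pn[X].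
by rewrite inE => /andP[XA /eqP]; exists X.
Qed.

Definition matching B f : Prop :=
  involutive f /\ forall x, f x != x -> [set x; f x] \in B.

Definition unmatched f : {set 'I_n} := [set x | f x == x].

(* If [u] is unmatched, match it to [w] instead; the former partner of [w], if
   there is one, becomes unmatched. *)
Definition graft f (u w : 'I_n) : 'I_n -> 'I_n := fun x =>
  if x == u then w else if x == w then u else if x == f w then x else f x.

Lemma graft_id f u w : graft f u w u = w. Proof. by rewrite /graft eqxx. Qed.

Lemma graftw f u w : u != w -> graft f u w w = u.
Proof. by rewrite /graft eq_sym eqxx => /negPf->. Qed.

Lemma graft_partner f u w : involutive f -> f u = u -> u != w -> f w != w ->
  graft f u w (f w) = f w.
Proof.
move=> fK fu uw fw; rewrite /graft eqxx (negPf fw).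
by case: eqP => // fwu; rewrite -(fK w) fwu fu eqxx in uw.
Qed.

Lemma graft_other f u w x : x != u -> x != w -> x != f w -> graft f u w x = f x.
Proof. by rewrite /graft => /negPf-> /negPf-> /negPf->. Qed.

Lemma unmatched_graft f u w x : involutive f -> f u = u -> u != w ->
  (x \in unmatched (graft f u w)) =
  [&& x != u, x != w & (x == f w) || (x \in unmatched f)].
Proof.
move=> fK fu uw; rewrite !inE /graft; case: (eqVneq x u) => [->|xu].
  by rewrite eq_sym (negPf uw).
case: (eqVneq x w) => [->|xw]; first by rewrite (negPf uw).
by case: (eqVneq x (f w)) => [->|xfw] //=; rewrite eqxx.
Qed.

Lemma matching_graft B f u w : matching B f -> f u = u -> u != w ->
  [set u; w] \in B -> matching B (graft f u w).
Proof.
move=> [fK fB] fu uw uwB; split=> x.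
  case: (eqVneq x u) => [->|xu]; first by rewrite graft_id graftw.
  case: (eqVneq x w) => [->|xw]; first by rewrite graftw // graft_id.
  case: (eqVneq x (f w)) => [xfw|xfw].
    by rewrite xfw graft_partner ?graft_partner //; rewrite -xfw.
  rewrite [in X in graft _ _ _ X]graft_other // graft_other ?fK //.
  - by apply: contraNneq xu => /(congr1 f); rewrite fK fu => ->.
  - by apply: contraNneq xfw => <-; rewrite fK.
  - by apply: contraNneq xw => /(inv_inj fK) ->.
case: (eqVneq x u) => [->|xu]; first by rewrite graft_id.
case: (eqVneq x w) => [->|xw]; first by rewrite graftw // setUC.
case: (eqVneq x (f w)) => [xfw|xfw].
  by rewrite xfw graft_partner ?eqxx //; rewrite -xfw.
by rewrite graft_other //; apply: fB.
Qed.

Lemma matching_sub B B' f : B \subset B' -> matching B f -> matching B' f.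
Proof. by move=> BB' [fK fB]; split=> // x /fB /(fintype.subsetP BB'). Qed.

(** The blocks [[set x; f x]] partition the moved vertices into pairs; one fixed point is tolerated
    because [n] may be odd. *)
Lemma has_matching_unmatched B f : matching B f -> (#|unmatched f| <= 1)%N ->
  has_matching B n./2.
Proof.
move=> [fK fB] U1; pose V := ~: unmatched f.
pose M := [set [set x; f x] | x in V].
have VP x : (x \in V) = (f x != x) by rewrite !inE.
have triv : finset.trivIset M.
  apply/trivIsetP => _ _ /imsetP[x _ ->] /imsetP[y _ ->]; apply: contraR => /pred0Pn[z].
  rewrite /= !inE => /andP[/orP[]/eqP-> /orP[]/eqP].
  - by move=> ->.
  - by move=> ->; rewrite fK setUC.
  - by move=> <-; rewrite fK setUC.
  - by move/(inv_inj fK) => ->.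
have part : partition M V.
  rewrite /partition triv andbC; apply/andP; split.
    apply/andP; split=> //.
    apply/imsetP => -[x _ /setP/(_ x)]; by rewrite !inE eqxx.
  apply/eqP/setP => z; apply/bigcupP/idP => [[_ /imsetP[x xV ->]]|zV].
    by rewrite !inE => /orP[]/eqP->; rewrite ?fK -?VP // eq_sym -VP.
  by exists [set z; f z]; [apply/imsetP; exists z | rewrite !inE eqxx].
have cV : #|V| = (#|M| * 2)%N.
  apply: (card_uniform_partition _ part) => _ /imsetP[x xV ->].
  by rewrite cards2 eq_sym -VP xV.
apply/existsP; exists M; rewrite triv /=; apply/andP; split.
  by apply/fintype.subsetP => _ /imsetP[x xV ->]; apply: fB; rewrite -VP.
have := cardsC (unmatched f); rewrite -/V cV card_ord => nE.
by apply/eqP; move: nE U1; move: #|_| #|_| => a b; lia.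
Qed.

End Matchings.

(** * Waiting times of greedy matching *)

Section Telescope.
Variables (R : realFieldType) (q : R) (c0 : nat).
Hypotheses (q_ge0 : 0 <= q) (c0_gt0 : (0 < c0)%N).

(** A telescoping majorant of the sum of [q / j^2] over [c0 < j <= c0 + c], bounded by [q / c0]
    whatever [c] is. *)
Definition telescope_sum (c : nat) : R := q * (c0%:R^-1 - (c0 + c)%:R^-1).

Lemma telescope_sum_mono c : telescope_sum c <= telescope_sum c.+1.
Proof.
rewrite ler_wpM2l // lerD2l lerN2 lef_pV2 ?posrE ?ltr0n ?addn_gt0 ?c0_gt0 //.
by rewrite ler_nat leq_add2l.
Qed.

Lemma telescope_sum_ge0 c : 0 <= telescope_sum c.
Proof.
rewrite mulr_ge0 // subr_ge0 lef_pV2 ?posrE ?ltr0n ?addn_gt0 ?c0_gt0 //.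
by rewrite ler_nat leq_addr.
Qed.

Lemma telescope_sum_le c : telescope_sum c <= q / c0%:R.
Proof. by rewrite ler_wpM2l // gerBl invr_ge0. Qed.

Lemma telescope_sum_step c :
  q <= (c0 + c.+1)%:R ^+ 2 * (telescope_sum c.+1 - telescope_sum c).
Proof.
set x : R := (c0 + c)%:R.
have x0 : 0 < x by rewrite ltr0n addn_gt0 c0_gt0.
rewrite /telescope_sum addnS -[(c0 + c).+1%:R]natr1 -/x -mulrBr mulrCA.
have -> : (x + 1) ^+ 2 * (c0%:R^-1 - (x + 1)^-1 - (c0%:R^-1 - x^-1)) = 1 + x^-1.
  have : c0%:R != 0 :> R by rewrite pnatr_eq0 -lt0n.
  clearbody x; move=> h; field; rewrite h !lt0r_neq0 ?addr_gt0 //.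
by rewrite ler_peMr // lerDl invr_ge0 ltW.
Qed.

End Telescope.

Section GreedyMatching.
Variables (R : realType) (n K : nat) (G : pred (graph n)).
Hypothesis K_gt0 : (0 < K)%N.
Implicit Types (B X E : graph n).
Notation loss := (loss R K G).
Notation half_sq := ((n * n)%:R / 2 : R).

Lemma half_sq_ge0 : 0 <= half_sq. Proof. by rewrite divr_ge0. Qed.

Lemma card_add_edge_le (e : {set 'I_n}) B c S b :
  (#|B| + c.+1 + S <= b)%N -> (#|e |: B| + c + S <= b)%N.
Proof. by rewrite cardsU1 addnS -addSn; apply: leq_trans; rewrite !leq_add2r; case: (_ \notin _). Qed.

Lemma unmatched_join (f : 'I_n -> 'I_n) u w : involutive f -> f u = u -> f w = w ->
  u != w -> unmatched (graft f u w) = unmatched f :\ u :\ w.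
Proof.
move=> fK fu fw uw; apply/setP => x; rewrite unmatched_graft // fw !inE.
by case: (eqVneq x u); case: (eqVneq x w).
Qed.

Lemma card_unmatched_join (f : 'I_n -> 'I_n) u w : involutive f -> f u = u -> f w = w ->
  u != w -> (#|unmatched f| = #|unmatched (graft f u w)| + 2)%N.
Proof.
move=> fK fu fw uw; rewrite unmatched_join //.
have uU : u \in unmatched f by rewrite inE fu.
have wU : w \in unmatched f :\ u by rewrite !inE fw eqxx andbT eq_sym.
by rewrite (cardsD1 u) uU (cardsD1 w (_ :\ u)) wU addnA addnC.
Qed.

(** With [j] pairs of unmatched vertices left, two disjoint sets of [j] such vertices span [j^2]
    useful edges, so the waits are of the form [q / j^2]. Halving the number of unmatched vertices
    forgets a possible odd one. [S] is the share of the edge budget [b] kept for later phases. *)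
Lemma greedy_matching_phase (T0 : nat) (eps : R) (c0 S b : nat) : (0 < c0)%N -> 0 <= eps ->
  (forall B f, matching B f -> (#|unmatched f|./2 = c0)%N -> (#|B| + S <= b)%N ->
     loss T0 B <= eps) ->
  forall F c B f, matching B f -> (#|unmatched f|./2 = c0 + c)%N ->
    (#|B| + c + S <= b)%N ->
  loss (T0 + c + F) B <= eps + half_sq / K%:R / c0%:R / F.+1%:R.
Proof.
move=> c00 eps0 next F c B f mf cf Bb.
have K0R : 0 < K%:R :> R by rewrite ltr0n.
have q0 : 0 <= half_sq / K%:R by rewrite divr_ge0 // half_sq_ge0.
apply: le_trans (_ : _ <= eps + telescope_sum (half_sq / K%:R) c0 c / F.+1%:R) _; last first.
  by rewrite lerD2l ler_wpM2r ?invr_ge0 // telescope_sum_le.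
pose P c B := (exists f, matching B f /\ (#|unmatched f|./2 = c0 + c)%N)
  /\ (#|B| + c + S <= b)%N.
apply: (@greedy_phase R n K G K_gt0 P (telescope_sum (half_sq / K%:R) c0) T0 eps) => //.
- exact: telescope_sum_ge0.
- exact: telescope_sum_mono.
- move=> {}c {}B [[{mf cf}f [mf cf]] {}Bb].
  case: c cf Bb => [|c] cf Bb; first by left; apply: (next B f); rewrite ?addn0 // in cf Bb *.
  right; have [X XU cX] : exists2 X : {set 'I_n}, X \subset unmatched f & #|X| = (c0 + c.+1)%N.
    by apply: exists_subset_card; lia.
  have [Y YU cY] : exists2 Y : {set 'I_n}, Y \subset unmatched f :\: X & #|Y| = (c0 + c.+1)%N.
    by apply: exists_subset_card; rewrite cardsDS // cX; lia.
  have dXY : [disjoint X & Y].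
    by move: YU; rewrite subsetD disjoint_sym => /andP[].
  exists c, (pair_edges X Y); split=> //.
  + exact: pair_edges_complete.
  + by apply: pair_edges_neq0; rewrite ?cX ?cY; lia.
  + move=> _ /pair_edgesP[x [y [xX yY ->]]].
    have fx : f x = x by apply/eqP; have := fintype.subsetP XU x xX; rewrite inE.
    have fy : f y = y.
      by apply/eqP; have := fintype.subsetP YU y yY; rewrite !inE => /andP[].
    have xy : x != y by apply: contraTneq yY => <-; rewrite (disjointFr dXY xX).
    split; last exact: card_add_edge_le.
    exists (graft f x y); split.
      by apply: matching_graft => //; [apply: matching_sub mf; exact: finset.subsetUr | rewrite !inE eqxx].
    by move: cf; rewrite (card_unmatched_join mf.1 fx fy xy) addn2 addnS => -[].
  + rewrite card_pair_edges // cX cY.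
    have := telescope_sum_step q0 c00 c.
    rewrite ler_pdivrMr // => /le_trans; apply.
    by rewrite mulrC mulrA -natrX -natrM mulnn.
- by split=> //; exists f.
Qed.

End GreedyMatching.

(** * Legs *)

Section Legs.
Variable n : nat.
Implicit Types (B : graph n) (f : 'I_n -> 'I_n) (C X : {set 'I_n})
  (o : 'I_n -> option 'I_n).

(* [o w = Some u] records the path u - w - f w, usable to move the unmatched
   vertex [u] to [f w]; the set [C] is kept free of such paths. *)
Definition legs C B f o : Prop := forall w u, o w = Some u ->
  [/\ f u = u, f w != w, [set u; w] \in B, o (f w) = None & (w \notin C) && (f w \notin C)].

Definition legset o u : {set 'I_n} := [set w | o w == Some u].

(** These are the middle vertices [w] of the legs; the far ends [f w] are obtained as the image
    under [f]. *)
Definition leg_ends o X : {set 'I_n} := [set w | if o w is Some u then u \in X else false].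

Definition add_leg o u w : 'I_n -> option 'I_n := fun x => if x == w then Some u else o x.

Definition deficient d f o : {set 'I_n} :=
  [set u in unmatched f | (#|legset o u| < d)%N].

Definition available C f o : {set 'I_n} :=
  [set w | [&& f w != w, o w == None, o (f w) == None, w \notin C & f w \notin C]].

(** Since [o] is a function, every [w] serves at most one unmatched vertex and leg sets are
    disjoint. *)
Lemma card_leg_ends o X : #|leg_ends o X| = (\sum_(u in X) #|legset o u|)%N.
Proof.
rewrite -sum1_card.
under [RHS]eq_bigr do rewrite -sum1_card.
rewrite (exchange_big_dep xpredT) //= [LHS]big_mkcond /=; apply: eq_bigr => w _.
rewrite inE; case ow: (o w) => [u|].
  rewrite (eq_bigl (fun v => (v \in X) && (v == u))); last first.
    by move=> v; rewrite inE ow eq_sym.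
  case uX: (u \in X).
    rewrite (eq_bigl (pred1 u)) ?big_pred1_eq // => v /=.
    by case: (eqVneq v u) => [->|_]; rewrite ?uX ?andbF.
  rewrite big_pred0 // => v.
  by case: (eqVneq v u) => [->|_]; rewrite ?uX ?andbF.
by rewrite big_pred0 // => v; rewrite inE ow andbF.
Qed.

Lemma legs_sub C B B' f o : B \subset B' -> legs C B f o -> legs C B' f o.
Proof. by move=> BB' l w u /l[? ? /(fintype.subsetP BB') ? ? ?]; split. Qed.

Lemma legs_none C B f : legs C B f (fun=> None). Proof. by []. Qed.

Lemma legs_add C B f o u w : involutive f -> legs C B f o -> f u = u -> w \in available C f o ->
  [set u; w] \in B -> legs C B f (add_leg o u w).
Proof.
move=> fK l fu; rewrite inE => /and5P[fw /eqP ow /eqP ofw wC fwC] uwB x v.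
rewrite /add_leg; case: (eqVneq x w) => [-> [<-]|xw ox].
  by split; rewrite ?(negPf fw) ?wC.
have [fv fx vxB ofx xC] := l _ _ ox; split=> //.
by case: eqP => // fxw; rewrite -fxw fK ox in ofw.
Qed.

Lemma legset_add_same o u w : o w = None -> #|legset (add_leg o u w) u| = #|legset o u|.+1.
Proof.
move=> ow; rewrite (_ : legset _ u = w |: legset o u).
  by rewrite cardsU1 inE ow.
by apply/setP => x; rewrite !inE /add_leg; case: (eqVneq x w) => [->|]; rewrite ?eqxx.
Qed.

Lemma legset_add_other o u w v : v != u -> o w = None -> legset (add_leg o u w) v = legset o v.
Proof.
move=> vu ow; apply/setP => x; rewrite !inE /add_leg; case: (eqVneq x w) => [->|//].
by rewrite ow; apply: contraNF vu => /eqP[->].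
Qed.

Lemma sum_deficits_add d f o v w : v \in deficient d f o -> o w = None ->
  (\sum_(u in unmatched f) (d - #|legset o u|) =
   (\sum_(u in unmatched f) (d - #|legset (add_leg o v w) u|)).+1)%N.
Proof.
rewrite inE => /andP[vU vd] ow.
rewrite (bigD1 v vU) (bigD1 v vU) /= legset_add_same // -addSn.
congr (_ + _)%N; first by rewrite subnSK.
by apply: eq_bigr => z /andP[_ zv]; rewrite legset_add_other.
Qed.

(** A vertex is lost only if it is unmatched, or if it or its partner carries a leg or lies in [C];
    the partners account for the factors 2. *)
Lemma card_available C B f o d : involutive f -> legs C B f o ->
  (forall u, (#|legset o u| <= d)%N) ->
  (n <= #|available C f o| + #|unmatched f| + 2 * (#|unmatched f| * d) + 2 * #|C|)%N.
Proof.
move=> fK l ld; pose L := leg_ends o (unmatched f).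
have cL : (#|L| <= #|unmatched f| * d)%N.
  by rewrite card_leg_ends -sum_nat_const; apply: leq_sum.
have LE w : (o w == None) = (w \notin L).
  rewrite inE; case ow: (o w) => [u|] //.
  by have [/eqP fu _ _ _ _] := l _ _ ow; rewrite inE fu.
have sub : [set: 'I_n] \subset available C f o :|: unmatched f :|: (L :|: f @: L) :|: (C :|: f @: C).
  apply/fintype.subsetP => x _.
  have imf (A : {set 'I_n}) : (x \in f @: A) = (f x \in A).
    by rewrite -{1}(fK x) mem_imset //; apply: inv_inj.
  move: (LE x) (LE (f x)); rewrite !finset.in_setU !imf.
  move: (x \in L) (f x \in L) => p q; rewrite !inE => -> ->.
  by case: (f x == x); case: p; case: q; case: (x \in C); case: (f x \in C).
have := subset_leq_card sub; rewrite cardsT card_ord => /leq_trans; apply.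
have fI : injective f := inv_inj fK.
apply: leq_trans (leq_card_setU _ _) _; apply: leq_add; last first.
  by apply: leq_trans (leq_card_setU _ _) _; rewrite card_imset // mul2n addnn.
apply: leq_trans (leq_card_setU _ _) _; apply: leq_add; first exact: leq_card_setU.
by apply: leq_trans (leq_card_setU _ _) _; rewrite card_imset // addnn -mul2n leq_mul2l cL.
Qed.

End Legs.

(** * Legs at most unmatched vertices *)

Section CollectMostLegs.
Variables (R : realType) (n K : nat) (G : pred (graph n)).
Hypothesis K_gt0 : (0 < K)%N.
Implicit Types (B X E : graph n).
Notation loss := (loss R K G).
Notation half_sq := ((n * n)%:R / 2 : R).
Notation none := (@finset.set0 'I_n).

(** While more than [c1] vertices are deficient, and since half of all vertices stay available, more
    than [c1 * n / 2] edges create a leg. Each of the at most [m * d] legs thus wastes at most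
    [n / (K * c1)] rounds on average. Leaving [c1] vertices deficient avoids the logarithm of a full
    collection. *)
Lemma collect_most_legs_phase (T0 : nat) (eps : R) (c1 d m S b : nat) f :
  (0 < c1)%N -> 0 <= eps -> involutive f ->
  (#|unmatched f| <= m)%N -> (2 * (m + 2 * (m * d)) <= n)%N ->
  (forall B o, matching B f -> legs none B f o -> (#|deficient d f o| <= c1)%N ->
     (#|B| + S <= b)%N -> loss T0 B <= eps) ->
  forall F B, matching B f -> (#|B| + m * d + S <= b)%N ->
  loss (T0 + m * d + F) B <= eps + (m * d)%:R * (n%:R / K%:R / c1%:R) / F.+1%:R.
Proof.
move=> c10 eps0 fK Um mn next F B mf Bb.
pose A (c : nat) : R := c%:R * (n%:R / K%:R / c1%:R).
have y0 : 0 <= n%:R / K%:R / c1%:R :> R by rewrite !divr_ge0.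
have A0 c : 0 <= A c by rewrite mulr_ge0.
have Am c : A c <= A c.+1 by rewrite ler_wpM2r // ler_nat.
pose P c B := exists o, [/\ matching B f, legs none B f o, forall u, (#|legset o u| <= d)%N,
   (\sum_(u in unmatched f) (d - #|legset o u|) = c)%N & (#|B| + c + S <= b)%N].
have step c B0 : P c B0 -> loss T0 B0 <= eps \/
     exists c' E, [/\ c = c'.+1, E \subset complete_graph n, E != finset.set0,
       forall e, e \in E -> P c' (e |: B0) &
       (n * n)%:R / 2 <= (K * #|E|)%:R * (A c - A c')].
  move=> [ o [{}mf l ld cE {}Bb]].
  have [le|gt] := leqP #|deficient d f o| c1.
    by left; apply: (next B0 o) => //; apply: leq_trans Bb; rewrite leq_add2r leq_addr.
  have [u uD] : exists u, u \in deficient d f o.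
    by apply/set0Pn; rewrite -card_gt0; apply: leq_trans gt.
  right; exists c.-1, (pair_edges (deficient d f o) (available none f o)).
  have av : (n <= 2 * #|available none f o|)%N.
    have := card_available fK l ld; rewrite cards0.
    have : (#|unmatched f| * d <= m * d)%N by rewrite leq_mul2r Um orbT.
    by move: Um mn; lia.
  have n0 : (0 < n)%N by apply: leq_ltn_trans (ltn_ord u).
  have dXY : [disjoint deficient d f o & available none f o].
    by rewrite -setI_eq0; apply/eqP/setP => z; rewrite !inE; case: (f z == z); rewrite ?andbF.
  have avpos : (0 < #|available none f o|)%N by move: n0 av; lia.
  have /card_gt0P[w0 w0A] := avpos.
  have avN w : w \in available none f o -> o w = None by rewrite inE => /and5P[_ /eqP].
  have cS : c = c.-1.+1 by rewrite -cE (sum_deficits_add uD (avN _ w0A)).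
  split=> //; first exact: pair_edges_complete.
  - by apply: pair_edges_neq0 => //; apply: leq_trans gt.
  - move=> _ /pair_edgesP[v [w [vD wA ->]]]; exists (add_leg o v w).
    have fv : f v = v by apply/eqP; move: vD; rewrite !inE => /andP[].
    have ow := avN w wA.
    split.
    + by apply: matching_sub mf; exact: finset.subsetUr.
    + apply: legs_add => //; last by rewrite !inE eqxx.
      by apply: legs_sub l; exact: finset.subsetUr.
    + move=> z; case: (eqVneq z v) => [->|zv]; last by rewrite legset_add_other.
      by rewrite legset_add_same //; move: vD; rewrite inE => /andP[].
    + by move: (sum_deficits_add vD ow); rewrite cE {1}cS => -[].
    + by apply: card_add_edge_le; rewrite -cS.
  - rewrite card_pair_edges // /A.
    have -> : c%:R * (n%:R / K%:R / c1%:R) - c.-1%:R * (n%:R / K%:R / c1%:R) =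
        n%:R / K%:R / c1%:R :> R by rewrite {1}cS -[c.-1.+1%:R]natr1; ring.
    have K0R : K%:R != 0 :> R by rewrite pnatr_eq0 -lt0n.
    have c0R : 0 < c1%:R :> R by rewrite ltr0n.
    rewrite !natrM; move: av gt; rewrite -(ltr_nat R) -(ler_nat R) natrM.
    move: (#|deficient _ _ _|%:R : R) (#|available _ _ _|%:R : R) => x y ny cx.
    have -> : K%:R * (x * y) * (n%:R / K%:R / c1%:R) = n%:R * y * (x / c1%:R).
      by field; rewrite K0R lt0r_neq0.
    have nR : 0 <= n%:R :> R by [].
    apply: le_trans (_ : _ <= n%:R * y * 1) _; first by nra.
    apply: ler_wpM2l; last by rewrite ler_pdivlMr // mul1r ltW.
    by nra.
apply: le_trans (_ : _ <= loss (T0 + #|unmatched f| * d + F) B) _.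
  by apply: loss_mono; rewrite leq_add2r leq_add2l leq_mul2r Um orbT.
apply: le_trans (_ : _ <= eps + A (#|unmatched f| * d)%N / F.+1%:R) _; last first.
  by rewrite lerD2l ler_wpM2r ?invr_ge0 // ler_wpM2r // ler_nat leq_mul2r Um orbT.
apply: (@greedy_phase R n K G K_gt0 P A T0 eps) => //.
exists (fun=> None); split=> //.
- by move=> u; rewrite (_ : legset _ u = finset.set0) ?cards0 //; apply/setP => x; rewrite !inE.
- rewrite -sum_nat_const; apply: eq_bigr => u _.
  by rewrite (_ : legset _ u = finset.set0) ?cards0 ?subn0 //; apply/setP => x; rewrite !inE.
- by apply: leq_trans Bb; rewrite leq_add2r leq_add2l leq_mul2r Um orbT.
Qed.

End CollectMostLegs.

(** * Augmenting along legs *)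

Section Drop.
Variable n : nat.
Implicit Types (B : graph n) (f : 'I_n -> 'I_n) (C X : {set 'I_n})
  (o : 'I_n -> option 'I_n).

Definition drop_legs o X : 'I_n -> option 'I_n := fun w =>
  if o w is Some u then (if u \in X then None else Some u) else None.

Lemma drop_legsP o X w u : drop_legs o X w = Some u <-> o w = Some u /\ u \notin X.
Proof.
rewrite /drop_legs; case: (o w) => [v|]; last by split=> [//|[]].
case: ifP => vX; first by split=> [//|[[<-]]]; rewrite vX.
by split=> [[<-]|[]//]; rewrite vX.
Qed.

Lemma drop_legs_None o X w : o w = None -> drop_legs o X w = None.
Proof. by rewrite /drop_legs => ->. Qed.

Lemma legset_drop o X u : u \notin X -> legset (drop_legs o X) u = legset o u.
Proof.
move=> uX; apply/setP => w; rewrite !inE; apply/eqP/eqP => [/drop_legsP[]//|ow].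
by apply/drop_legsP.
Qed.

(* The matching may be changed along the legs of the vertices of [X] and inside
   [C] without damaging the other legs. *)
Lemma legs_drop C B f f' o X : legs C B f o ->
  (forall w u, o w = Some u -> u \notin X -> [/\ f' u = u & f' w = f w]) ->
  legs C B f' (drop_legs o X).
Proof.
move=> l h w u /drop_legsP[ow uX]; have [fu fw uwB ofw wC] := l _ _ ow.
by have [f'u f'w] := h _ _ ow uX; split; rewrite ?f'w // drop_legs_None.
Qed.

End Drop.

Section MergeLegs.
Variables (R : realType) (n K : nat) (G : pred (graph n)).
Hypothesis K_gt0 : (0 < K)%N.
Implicit Types (B X E : graph n).
Notation loss := (loss R K G).
Notation half_sq := ((n * n)%:R / 2 : R).
Notation none := (@finset.set0 'I_n).

(** The path [u1 - w - f w - u2] is flipped by two grafts: the first moves the free end from [u1] to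
    [f w], the second joins [f w] to [u2]. Legs of different vertices are disjoint, so only those of
    [u1] and [u2] are given up. *)
Lemma augment_legs B f o (u1 u2 w : 'I_n) : matching B f -> legs none B f o ->
  o w = Some u1 -> f u2 = u2 -> u2 != u1 -> [set u2; f w] \in B ->
  let f2 := graft (graft f u1 w) (f w) u2 in
  [/\ matching B f2, unmatched f2 = unmatched f :\ u1 :\ u2 &
      legs none B f2 (drop_legs o [set u1; u2])].
Proof.
move=> mf l ow fu2 u21 e f2; have [fK _] := mf.
have [fu1 fw u1w ofw _] := l _ _ ow.
have u1w' : u1 != w by apply: contraNneq fw => <-; rewrite fu1.
have u2w : u2 != w by apply: contraNneq fw => <-; rewrite fu2.
have u2fw : u2 != f w by apply: contraNneq u2w => u2fw; rewrite -fu2 u2fw fK.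
have u1fw : u1 != f w by apply: contraNneq u1w' => u1fw; rewrite -fu1 u1fw fK.
have m1 : matching B (graft f u1 w) by apply: matching_graft.
have [f1K _] := m1.
have f1fw : graft f u1 w (f w) = f w by apply: graft_partner.
have f1u2 : graft f u1 w u2 = u2 by rewrite graft_other.
split.
- by apply: matching_graft => //; rewrite 1?eq_sym // setUC.
- apply/setP => x; rewrite unmatched_join //; last by rewrite eq_sym.
  rewrite !finset.in_setD1 unmatched_graft //.
  case: (eqVneq x u2) => //= xu2; case: (eqVneq x (f w)) => [->|xfw] /=.
    by rewrite inE fK (eq_sym w) (negPf fw) andbF.
  case: (eqVneq x u1) => //= xu1; case: (eqVneq x w) => [->|] //=.
  by rewrite inE (negPf fw).
- apply: (legs_drop l) => x v ox; rewrite !inE negb_or => /andP[vu1 vu2].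
  have [fv fx _ ofx _] := l _ _ ox.
  have xw : x != w by apply: contraNneq vu1 => xw; move: ox; rewrite xw ow => -[->].
  have xfw : x != f w by apply/eqP => xe; rewrite xe ofw in ox.
  have vw : v != w by apply: contraNneq fw => <-; rewrite fv.
  have vfw : v != f w by apply: contraNneq vw => vfw; rewrite -fv vfw fK.
  have xu (z : 'I_n) : f z = z -> x != z by move=> fz; apply: contraNneq fx => ->; rewrite fz.
  have keep z : z != u1 -> z != w -> z != f w -> z != u2 -> f2 z = f z.
    by move=> zu1 zw zfw zu2; rewrite /f2 graft_other ?f1u2 // graft_other.
  by split; [rewrite -[RHS]fv|]; apply: keep => //; apply: xu.
Qed.

(** With [j] pairs left, [j] vertices that are not deficient have together at least [j * d] leg
    ends, and joining one of these to one of [j] other unmatched vertices augments. This gives [d]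
    times as many useful edges as direct matching, so one can stop [d] times lower for the same
    wait. No new deficient vertex arises, since only vertices that become matched lose their
    legs. *)
Lemma merge_legs_phase (T0 : nat) (eps : R) (c1 d S b : nat) :
  (0 < c1)%N -> (0 < d)%N -> 0 <= eps ->
  (forall B f, matching B f -> (#|unmatched f|./2 = c1)%N -> (#|B| + S <= b)%N ->
     loss T0 B <= eps) ->
  forall F c B f o, matching B f -> legs none B f o -> (#|deficient d f o| <= c1)%N ->
    (#|unmatched f|./2 = c1 + c)%N -> (#|B| + c + S <= b)%N ->
  loss (T0 + c + F) B <= eps + half_sq / (K * d)%:R / c1%:R / F.+1%:R.
Proof.
move=> c10 d0 eps0 next F c B f o mf l df cf Bb.
have K0R : 0 < (K * d)%:R :> R by rewrite ltr0n muln_gt0 K_gt0.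
have q0 : 0 <= half_sq / (K * d)%:R by rewrite divr_ge0 // half_sq_ge0.
set q := half_sq / (K * d)%:R in q0 *.
apply: le_trans (_ : _ <= eps + telescope_sum q c1 c / F.+1%:R) _; last first.
  by rewrite lerD2l ler_wpM2r ?invr_ge0 // telescope_sum_le.
pose P c B := (exists f o, [/\ matching B f, legs none B f o,
  (#|deficient d f o| <= c1)%N & (#|unmatched f|./2 = c1 + c)%N]) /\ (#|B| + c + S <= b)%N.
apply: (@greedy_phase R n K G K_gt0 P (telescope_sum q c1) T0 eps) => //; last 1 first.
- by split=> //; exists f, o.
- exact: telescope_sum_ge0.
- exact: telescope_sum_mono.
move=> {l mf df cf f o}c' {}B [[f [ o [mf l df cf]]] {}Bb].
case: c' cf Bb => [|c'] cf Bb; first by left; apply: (next B f); rewrite ?addn0 // in cf Bb *.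
have [fK _] := mf.
right; have [X XU cX] : exists2 X : {set 'I_n},
    X \subset unmatched f :\: deficient d f o & #|X| = (c1 + c'.+1)%N.
  apply: exists_subset_card; rewrite cardsDS; last by apply/fintype.subsetP => x; rewrite inE => /andP[].
  by move: df cf; lia.
pose Y := f @: leg_ends o X; pose Z := unmatched f :\: X.
have cY : (#|X| * d <= #|Y|)%N.
  rewrite card_imset; last exact: inv_inj.
  rewrite card_leg_ends -sum_nat_const; apply: leq_sum => u /(fintype.subsetP XU).
  by rewrite !inE negb_and -leqNgt => /andP[/orP[/negPf->|]].
have cZ : (c1 + c'.+1 <= #|Z|)%N.
  rewrite cardsDS ?cX; last by apply: fintype.subset_trans XU (finset.subsetDl _ _).
  by move: cf; lia.
have YP y : y \in Y -> exists w u1, [/\ y = f w, o w = Some u1, u1 \in X & f w != w].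
  move=> /imsetP[w]; rewrite inE; case ow: (o w) => [u1|//] u1X ->.
  by exists w, u1; have [_ ? _ _ _] := l _ _ ow.
have dZY : [disjoint Z & Y].
  rewrite -setI_eq0; apply/eqP/setP => y; rewrite !inE; apply/negP.
  by case/andP=> /andP[_ /eqP fy] /YP[w [u1 [yE _ _]]]; rewrite -{1}yE -fy yE fK eqxx.
exists c', (pair_edges Z Y); split=> //.
- exact: pair_edges_complete.
- apply: pair_edges_neq0; first by apply: leq_trans cZ; rewrite addnS.
  by apply: leq_trans cY; rewrite muln_gt0 d0 cX addnS.
- move=> _ /pair_edgesP[u2 [y [u2Z /YP[w [u1 [-> ow u1X fw]]] ->]]].
  move: u2Z; rewrite !inE => /andP[u2X /eqP fu2].
  have u21 : u2 != u1 by apply: contraNneq u2X => ->.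
  have BB : B \subset [set u2; f w] |: B by apply: finset.subsetUr.
  have [|m2 u2E l2] := augment_legs (matching_sub BB mf) (legs_sub BB l) ow fu2 u21.
    by rewrite !inE eqxx.
  split; last exact: card_add_edge_le.
  exists (graft (graft f u1 w) (f w) u2), (drop_legs o [set u1; u2]); split=> //.
    apply: leq_trans df; apply: subset_leq_card; apply/fintype.subsetP => x.
    rewrite inE u2E !finset.in_setD1 => /andP[/and3P[xu2 xu1 xU]].
    by rewrite legset_drop ?inE ?negb_or ?xu1 // => xd; move: xU; rewrite inE => ->.
  have u1U : u1 \in unmatched f by have [/eqP ? _ _ _ _] := l _ _ ow; rewrite inE.
  have u2U : u2 \in unmatched f :\ u1 by rewrite !inE u21 fu2 eqxx.
  by rewrite u2E; move: cf; rewrite (cardsD1 u1) u1U (cardsD1 u2 (_ :\ u1)) u2U addnS => -[].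
- rewrite card_pair_edges //.
  have := telescope_sum_step q0 c10 c'.
  rewrite {1}/q ler_pdivrMr // => /le_trans; apply.
  rewrite mulrAC ler_wpM2r ?subr_ge0 ?telescope_sum_mono // -natrX -natrM ler_nat.
  rewrite cX in cY.
  apply: (@leq_trans (K * ((c1 + c'.+1) * ((c1 + c'.+1) * d)))); first by nia.
  by rewrite leq_mul2l leq_mul ?orbT.
Qed.

End MergeLegs.

(** * The reserve *)

Section LinkReserve.
Variables (R : realType) (n K : nat) (G : pred (graph n)).
Hypothesis K_gt0 : (0 < K)%N.
Implicit Types (B X E : graph n).
Notation loss := (loss R K G).
Notation half_sq := ((n * n)%:R / 2 : R).

(** The pair [{x, f x}] is represented by [x] in [A], and an edge between [f j] and [l] acts as an
    arc from [j] to [l]: an alternating path entering a pair at [j] leaves it at [f j] and may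
    continue at [l]. *)
Definition linked (f : 'I_n -> 'I_n) (A : {set 'I_n}) (k : nat) B : Prop :=
  forall J L : {set 'I_n}, J \subset A -> L \subset A -> [disjoint J & L] ->
  #|J| = k -> #|L| = k -> exists j l, [/\ j \in J, l \in L & [set f j; l] \in B].

Definition unlinked_pairs (f : 'I_n -> 'I_n) (A : {set 'I_n}) (k : nat) B :
    {set {set 'I_n} * {set 'I_n}} :=
  [set p : {set 'I_n} * {set 'I_n} | [&& p.1 \subset A, p.2 \subset A, [disjoint p.1 & p.2], #|p.1| == k, #|p.2| == k
     & [disjoint pair_edges (f @: p.1) p.2 & B]]].

Lemma linked_unlinked_pairs f A k B : unlinked_pairs f A k B = finset.set0 -> linked f A k B.
Proof.
move=> e0 J L JA LA JL cJ cL; have : (J, L) \notin unlinked_pairs f A k B by rewrite e0 inE.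
rewrite inE JA LA JL cJ cL eqxx /= => /pred0Pn[e /andP[/pair_edgesP[_ [l [/imsetP[j jJ ->] lL ->]]] eB]].
by exists j, l.
Qed.

Lemma card_unlinked_pairs_le f A k B : (#|unlinked_pairs f A k B| <= 4 ^ #|A|)%N.
Proof.
apply: (@leq_trans #|setX (powerset A) (powerset A)|).
  by apply/subset_leq_card/fintype.subsetP => -[J L]; rewrite !inE => /and3P[-> ->].
by rewrite cardsX card_powerset -expnMn.
Qed.

(** A uniform edge among the at most [#|A| ^ 2] missing reserve edges hits each unlinked pair
    through [k ^ 2] of them. The mean number of unlinked pairs therefore shrinks by the factor in
    the statement, starting from at most [4 ^ #|A|]. While an unlinked pair exists, at least [k ^ 2]
    edges are useful. *)
Lemma link_reserve_phase (T0 : nat) (eps : R) (k S b : nat) f (A : {set 'I_n}) :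
  (0 < k)%N -> (k <= #|A|)%N -> 0 <= eps -> [disjoint A & f @: A] -> involutive f ->
  (forall B, matching B f -> linked f A k B -> (#|B| + S <= b)%N -> loss T0 B <= eps) ->
  forall F c B, matching B f -> (#|B| + c + S <= b)%N ->
  loss (T0 + c + F) B <=
    eps + (4 ^ #|A|)%:R * (1 - (k ^ 2)%:R / (#|A| ^ 2)%:R) ^+ c
        + c%:R * (half_sq / (K * k ^ 2)%:R) / F.+1%:R.
Proof.
move=> k0 kA eps0 dA fK next F c B mf Bb.
pose W c B : R := #|unlinked_pairs f A k B|%:R * (1 - (k ^ 2)%:R / (#|A| ^ 2)%:R) ^+ c.
have k2 : 0 < (k ^ 2)%:R :> R by rewrite ltr0n expn_gt0 k0.
have A2 : 0 < (#|A| ^ 2)%:R :> R by rewrite ltr0n expn_gt0 (leq_trans k0 kA).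
have K0R : 0 < K%:R :> R by rewrite ltr0n.
have r0 : 0 <= 1 - (k ^ 2)%:R / (#|A| ^ 2)%:R :> R.
  by rewrite subr_ge0 ler_pdivrMr // mul1r ler_nat leq_sqr.
have W0 c' B' : 0 <= W c' B' by rewrite mulr_ge0 // exprn_ge0.
pose a : R := half_sq / (K * k ^ 2)%:R.
have a0 : 0 <= a by rewrite divr_ge0 // half_sq_ge0.
pose P c B := matching B f /\ (#|B| + c + S <= b)%N.
apply: le_trans (_ : _ <= eps + W c B + c%:R * a / F.+1%:R) _; last first.
  rewrite lerD2r lerD2l ler_wpM2r ?exprn_ge0 // ler_nat; exact: card_unlinked_pairs_le.
apply: (@potential_phase R n K G K_gt0 P W (fun c => c%:R * a) T0 eps) => //.
- by move=> c'; rewrite mulr_ge0.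
- by move=> c'; rewrite ler_wpM2r // ler_nat.
move=> {mf}c' {}B [mf {}Bb].
have [U0|[[J L] JLU]] := set_0Vmem (unlinked_pairs f A k B).
  constructor 1; apply: le_trans (_ : eps <= _); last by rewrite lerDl.
  apply: next => //; first exact: linked_unlinked_pairs.
  by apply: leq_trans Bb; rewrite leq_add2r leq_addr.
case: c' Bb => [|c'] Bb.
  (* No step is left although some pair is unlinked: then [W] is at least 1. *)
  constructor 1; apply: le_trans (loss_le1 _ _ _ _ _) _.
  rewrite -[leLHS]add0r; apply: lerD => //; rewrite /W expr0 mulr1.
  by rewrite ler1n card_gt0; apply/set0Pn; exists (J, L).
constructor 3; pose E := pair_edges (f @: A) A :\: B.
have pairE p : p \in unlinked_pairs f A k B ->
    pair_edges (f @: p.1) p.2 \subset E /\ #|pair_edges (f @: p.1) p.2| = (k ^ 2)%N.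
  case: p => J1 L1; rewrite inE => /and5P[/= J1A L1A _ /eqP cJ /andP[/eqP cL dB]].
  split.
    rewrite subsetD dB andbT; apply/fintype.subsetP => e /pair_edgesP[x [y [xJ yL ->]]].
    apply/pair_edgesP; exists x, y; split=> //; last exact: (fintype.subsetP L1A).
    by move: x xJ; apply/fintype.subsetP; apply: imsetS.
  rewrite card_pair_edges ?card_imset ?cJ ?cL //; first exact: inv_inj.
  rewrite disjoint_sym; apply: disjointWl L1A _; apply: disjointWr dA; exact: imsetS.
have cE : (k ^ 2 <= #|E| <= #|A| ^ 2)%N.
  have [sE <-] := pairE _ JLU; rewrite subset_leq_card //=.
  apply: leq_trans (subset_leq_card (finset.subsetDl _ _)) _.
  rewrite card_pair_edges 1?disjoint_sym // card_imset //; exact: inv_inj.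
have /andP[cE1 cE2] := cE.
have EM : E \subset missing B.
  rewrite subsetD disjoint_sym disjoints_subset; apply/andP; split; last first.
    by apply/fintype.subsetP => e; rewrite !inE => ->.
  apply: fintype.subset_trans (finset.subsetDl _ _) _.
  by apply: pair_edges_complete; rewrite disjoint_sym.
exists c', E; split=> //.
- by rewrite -card_gt0; apply: leq_trans cE1; rewrite expn_gt0 k0.
- move=> e eE; split; last exact: card_add_edge_le.
  by apply: matching_sub mf; exact: finset.subsetUr.
split; last first.
  rewrite -mulrBl -[c'.+1%:R]natr1 addrAC subrr add0r mul1r /a.
  rewrite mulrCA ler_peMr ?half_sq_ge0 //.
  by rewrite ler_pdivlMr ?mul1r ?ler_nat ?leq_mul2l ?cE1 ?orbT // ltr0n muln_gt0 K_gt0 expn_gt0 k0.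
(* A pair stays unlinked exactly when [e] avoids its [k ^ 2] edges, all of which lie in [E]; the sum
   over [e] is taken first. *)
have sumE : \sum_(e in E) #|unlinked_pairs f A k (e |: B)|%:R =
    #|unlinked_pairs f A k B|%:R * (#|E|%:R - (k ^ 2)%:R) :> R.
  transitivity (\sum_(e in E) \sum_(p in unlinked_pairs f A k B)
      (e \notin pair_edges (f @: p.1) p.2)%:R : R).
    apply: eq_bigr => e eE; rewrite -sum1_card natr_sum big_mkcond [RHS]big_mkcond /=.
    apply: eq_bigr => p _; rewrite !inE.
    have -> : [disjoint pair_edges (f @: p.1) p.2 & e |: B] =
        (e \notin pair_edges (f @: p.1) p.2) && [disjoint pair_edges (f @: p.1) p.2 & B].
      by rewrite !disjoints_subset finset.setCU finset.subsetI -!disjoints_subset [X in X && _]disjoint_sym disjoints1.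
    by case: (_ \subset A); case: (_ \subset A); case: [disjoint _ & _];
       case: (_ == k); case: (_ == k); case: (e \in _); case: [disjoint _ & _].
  rewrite exchange_big /= mulr_natl -sumr_const; apply: eq_bigr => p /pairE[pE cp].
  rewrite -cp -(cardsID (pair_edges (f @: p.1) p.2) E) (setIidPr pE) natrD addrAC subrr add0r.
  rewrite -sum1_card natr_sum big_mkcond [RHS]big_mkcond /=; apply: eq_bigr => e _.
  by rewrite [in RHS]finset.in_setD; case: (e \in E); case: (e \in pair_edges (f @: p.1) p.2).
rewrite /W -mulr_suml sumE exprSr.
set r := 1 - _ in r0 *; set U : R := #|unlinked_pairs f A k B|%:R.
have -> : U * (#|E|%:R - (k ^ 2)%:R) * r ^+ c' = U * r ^+ c' * (#|E|%:R - (k ^ 2)%:R) by ring.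
have -> : #|E|%:R * (U * (r ^+ c' * r)) = U * r ^+ c' * (#|E|%:R * r) by ring.
rewrite ler_wpM2l ?mulr_ge0 ?exprn_ge0 // /r mulrBr mulr1 lerD2l lerN2.
by rewrite mulrCA ler_piMr // ler_pdivrMr // mul1r ler_nat.
Qed.

End LinkReserve.

(** * Legs at every unmatched vertex *)

Section CollectAllLegs.
Variables (R : realType) (n K : nat) (G : pred (graph n)).
Hypothesis K_gt0 : (0 < K)%N.
Implicit Types (B X E : graph n) (f : 'I_n -> 'I_n) (o : 'I_n -> option 'I_n).
Notation loss := (loss R K G).
Notation half_sq := ((n * n)%:R / 2 : R).

(* The exponential moment [\sum_u theta ^ (missing legs of u)]; it shrinks by a
   factor [1 - kappa] in each round, which gives the sharp constant in the
   number of rounds. *)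
Definition deficit_weight (theta : R) (d : nat) (f : 'I_n -> 'I_n) o : R :=
  \sum_(u in unmatched f) (if (#|legset o u| < d)%N then theta ^+ (d - #|legset o u|) else 0).

Lemma deficit_weight_add theta d f o u w : 1 <= theta -> u \in deficient d f o ->
  o w = None ->
  deficit_weight theta d f (add_leg o u w) <=
  deficit_weight theta d f o - (1 - theta^-1) * theta ^+ (d - #|legset o u|).
Proof.
move=> th1; rewrite inE => /andP[uU ud] ow; rewrite /deficit_weight.
have th0 : 0 < theta by apply: lt_le_trans th1.
rewrite (bigD1 u uU) [in leRHS](bigD1 u uU) /= ud legset_add_same //.
rewrite (eq_bigr (fun v => if (#|legset o v| < d)%N then theta ^+ (d - #|legset o v|) else 0));
  last by move=> v /andP[_ vu]; rewrite legset_add_other.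
rewrite [leRHS]addrAC lerD2r.
have -> : theta ^+ (d - #|legset o u|) - (1 - theta^-1) * theta ^+ (d - #|legset o u|) =
   theta ^+ (d - #|legset o u|.+1).
  by rewrite -(subnSK ud) exprS; field; rewrite lt0r_neq0.
by case: ifP => // _; rewrite exprn_ge0 ?ltW.
Qed.

Lemma deficit_weight_ge0 theta d f o : 1 <= theta -> 0 <= deficit_weight theta d f o.
Proof.
move=> th1; apply: sumr_ge0 => u _; case: ifP => // _.
by rewrite exprn_ge0 // (le_trans ler01).
Qed.

Lemma deficit_weight_deficient theta d f o :
  deficit_weight theta d f o = \sum_(u in deficient d f o) theta ^+ (d - #|legset o u|).
Proof.
rewrite /deficit_weight -big_mkcondr /=; apply: eq_bigl => u; by rewrite !inE.
Qed.

(** [kappa] is a lower bound for the hit probability times the mean relative drop of the weight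
    after a hit. In its denominator, [K * (m * n)] takes over from [n^2 / 2] when [K] is so large
    that a hit is almost certain. The number of rounds is fixed here, so the bound decays
    exponentially in [T] instead of coming from Markov's inequality on failures. *)
Lemma collect_all_legs_phase (T0 : nat) (eps theta : R) (d k m S b av : nat) f (A C : {set 'I_n}) :
  (0 < m)%N -> (#|unmatched f| <= m)%N -> 0 <= eps -> 1 <= theta -> involutive f ->
  (m + 2 * (m * d) + 2 * #|C| + av <= n)%N ->
  (forall B o, matching B f -> linked f A k B -> legs C B f o ->
     (forall u, u \in unmatched f -> (d <= #|legset o u|)%N) ->
     (#|B| + S <= b)%N -> loss T0 B <= eps) ->
  let kappa := (K * av)%:R * (1 - theta^-1) / ((K * (m * n))%:R + half_sq) in
  forall T B, matching B f -> linked f A k B -> (#|B| + m * d + S <= b)%N ->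
  loss (T0 + T) B <= eps + (1 - kappa) ^+ T * (m%:R * theta ^+ d).
Proof.
move=> m0 Um eps0 th1 fK avn next kappa T0' B0 mf0 lk0 Bb0.
have th0 : 0 < theta by apply: lt_le_trans th1.
have tau0 : 0 <= 1 - theta^-1 by rewrite subr_ge0 invf_le1.
have none0 u : #|legset (fun=> None : option 'I_n) u| = 0%N.
  by apply/eqP; rewrite cards_eq0; apply/eqP/setP => x; rewrite !inE.
have half0 : 0 <= half_sq by apply: half_sq_ge0.
have n0 : (0 < n)%N by apply: leq_trans avn; rewrite -!addnA ltn_addr.
have D0 : 0 < (K * (m * n))%:R + half_sq.
  by apply: ltr_pwDl => //; rewrite ltr0n !muln_gt0 K_gt0 m0.
have k1 : 0 <= 1 - kappa.
  rewrite subr_ge0 ler_pdivrMr // mul1r.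
  apply: le_trans (_ : _ <= (K * av)%:R * 1) _.
    by rewrite ler_wpM2l // gerBl invr_ge0 ltW.
  rewrite mulr1; apply: le_trans (_ : _ <= (K * (m * n))%:R) _; last by rewrite lerDl.
  by rewrite ler_nat leq_mul2l; apply/orP; right; apply: (@leq_trans n); [apply: leq_trans avn; exact: leq_addl|rewrite leq_pmull].
(* The fuel bounds [T + c] because a useful edge already in the graph yields a leg at once: [c]
   drops while [T] does not. *)
suff H N T c o B : (T + c <= N)%N -> matching B f -> linked f A k B -> legs C B f o ->
    (forall u, (#|legset o u| <= d)%N) ->
    (\sum_(u in unmatched f) (d - #|legset o u|) = c)%N -> (#|B| + c + S <= b)%N ->
    loss (T0 + T) B <= eps + (1 - kappa) ^+ T * deficit_weight theta d f o.
  have Bb0' : (#|B0| + #|unmatched f| * d + S <= b)%N.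
    by apply: leq_trans Bb0; rewrite leq_add2r leq_add2l leq_mul2r Um orbT.
  have Hc : (\sum_(u in unmatched f) (d - #|legset (fun=> None : option 'I_n) u|) =
      #|unmatched f| * d)%N.
    by rewrite -sum_nat_const; apply: eq_bigr => u _; rewrite none0 subn0.
  have := H _ T0' _ (fun=> None) B0 (leqnn _) mf0 lk0 (@legs_none _ C B0 f) _ Hc Bb0'.
  move=> /(_ _)/le_trans; apply; first by move=> u; rewrite none0.
  rewrite lerD2l ler_wpM2l ?exprn_ge0 // /deficit_weight.
  apply: le_trans (_ : _ <= #|unmatched f|%:R * theta ^+ d) _; last first.
    by rewrite ler_wpM2r ?ler_nat // exprn_ge0 // ltW.
  rewrite mulr_natl -sumr_const.
  by apply: ler_sum => u _; rewrite none0 subn0; case: ifP => // _; rewrite exprn_ge0 ?ltW.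
elim: N T c o B => [|N IH] T c o B TcN mf lk l ld cE Bb.
all: have [D_0|Dpos] := posnP #|deficient d f o|.
1,3: apply: le_trans (loss_mono _ _ _ _ (leq_addr _ _)) _;
  apply: le_trans (_ : _ <= eps) _;
  [apply: (next B o) => // [u uU|];
    [rewrite leqNgt; apply/negP => ud;
     by have := cards0_eq D_0; move/setP/(_ u); rewrite !inE ud andbT => uf; rewrite inE uf in uU
    |by apply: leq_trans Bb; rewrite leq_add2r leq_addr]
  |by rewrite lerDl mulr_ge0 ?exprn_ge0 // deficit_weight_ge0].
(* One deficient vertex already weighs at least 1, so the bound is trivial when no round is left. *)
all: have weight1 : 1 <= deficit_weight theta d f o
  by have /card_gt0P[u uD] := Dpos; rewrite deficit_weight_deficient (bigD1 u uD) /=;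
     rewrite -[leLHS]addr0; apply: lerD; [rewrite exprn_ege1|apply: sumr_ge0 => v _; rewrite exprn_ge0 ?ltW].
all: have trivial_bound : loss (T0 + 0) B <= eps + (1 - kappa) ^+ 0 * deficit_weight theta d f o
  by apply: le_trans (loss_le1 _ _ _ _ _) _; rewrite expr0 mul1r -[leLHS]add0r; apply: lerD.
  by case: T TcN => [|T] //.
case: T TcN => [//|T] TcN.
pose Av := available C f o; pose E := pair_edges (deficient d f o) Av.
have cAv : (av <= #|Av|)%N.
  have arith a u c2 md : (n <= a + u + 2 * (u * d) + c2 -> u <= m -> u * d <= md ->
      m + 2 * md + c2 + av <= n -> av <= a)%N by clear; lia.
  by apply: (arith _ _ _ _ (card_available fK l ld) Um _ avn); rewrite leq_mul2r Um orbT.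
have ow w : w \in Av -> o w = None by rewrite inE => /and5P[_ /eqP].
have dXY : [disjoint deficient d f o & Av].
  by rewrite -setI_eq0; apply/eqP/setP => z; rewrite !inE; case: (f z == z); rewrite ?andbF.
have add_ok T' c' v w : v \in deficient d f o -> w \in Av -> (T' + c' <= N)%N -> c = c'.+1 ->
   forall B', B \subset B' -> [set v; w] \in B' -> (#|B'| + c' + S <= b)%N ->
   loss (T0 + T') B' <= eps + (1 - kappa) ^+ T' * deficit_weight theta d f (add_leg o v w).
  move=> vD wA Tc' cE' B' BB' eB' Bb'; apply: (IH _ c') => //.
  - exact: matching_sub mf.
  - move=> J L JA LA JL cJ cL; have [j [x [jJ xL e]]] := lk J L JA LA JL cJ cL.
    by exists j, x; split=> //; apply: (fintype.subsetP BB').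
  - apply: legs_add => //; first by apply: legs_sub l.
    by apply/eqP; move: vD; rewrite !inE => /andP[].
  - move=> z; case: (eqVneq z v) => [->|zv]; last by rewrite legset_add_other ?ow.
    by rewrite legset_add_same ?ow //; move: vD; rewrite inE => /andP[].
  - by move: cE; rewrite (sum_deficits_add vD (ow w wA)) cE' => -[].
have lower v w : v \in deficient d f o -> w \in Av ->
    deficit_weight theta d f (add_leg o v w) <= deficit_weight theta d f o.
  move=> vD wA; apply: le_trans (deficit_weight_add th1 vD (ow w wA)) _.
  by rewrite gerBl mulr_ge0 // exprn_ge0 // ltW.
have cS v w : v \in deficient d f o -> w \in Av -> c = c.-1.+1.
  by move=> vD wA; rewrite -cE (sum_deficits_add vD (ow w wA)).
have [EB|[e /setIP[/pair_edgesP[v [w [vD wA ->]]] eB]]] := set_0Vmem (E :&: B); last first.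
  apply: le_trans (_ : _ <= eps + (1 - kappa) ^+ T.+1 * deficit_weight theta d f (add_leg o v w)) _.
    apply: (add_ok T.+1 c.-1) => //; [|exact: cS vD wA|].
      by move: TcN; rewrite {1}(cS _ _ vD wA) addnS ltnS.
    by apply: leq_trans Bb; rewrite leq_add2r leq_add2l leq_pred.
  by rewrite lerD2l ler_wpM2l ?exprn_ge0 // lower.
rewrite addnS; set W := deficit_weight theta d f o in weight1 lower *.
set y := (1 - kappa) ^+ T.
have y0 : 0 <= y by rewrite exprn_ge0.
have miss : loss (T0 + T) B <= eps + y * W by apply: (IH _ c) => //; move: TcN; rewrite addSn.
rewrite exprS -/y.
(* Without a guaranteed available vertex [E] might be empty, but then [kappa] is 0. *)
have [av0|av0] := posnP av.
  have -> : kappa = 0 by rewrite /kappa av0 muln0 !mul0r.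
  by rewrite subr0 mul1r; apply: le_trans (loss_monoS _ _ _ _ _) miss.
have EM : E \subset missing B.
  by rewrite subsetD pair_edges_complete //= -setI_eq0 EB.
have E0 : E != finset.set0 by apply: pair_edges_neq0 => //; apply: leq_trans cAv.
have [p [p0 p1 pE hl]] := @one_step R n K G (T0 + T) B E K_gt0 EM E0.
apply: le_trans hl _.
have Epos : 0 < #|E|%:R :> R by rewrite ltr0n card_gt0.
pose tau := 1 - theta^-1.
have hit : \sum_(e in E) loss (T0 + T) (e |: B) <=
    #|E|%:R * (eps + y * W) - y * (#|Av|%:R * tau * W).
  rewrite sum_pair_edges //.
  apply: le_trans (_ : _ <= \sum_(v in deficient d f o) \sum_(w in Av)
     (eps + y * (W - tau * theta ^+ (d - #|legset o v|)))) _.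
    apply: ler_sum => v vD; apply: ler_sum => w wA.
    apply: le_trans (_ : _ <= eps + y * deficit_weight theta d f (add_leg o v w)) _.
      apply: (add_ok T c.-1) => //.
      - by move: TcN; rewrite addSn ltnS => /(leq_trans _); apply; rewrite leq_add2l leq_pred.
      - exact: cS vD wA.
      - exact: finset.subsetUr.
      - by rewrite !inE eqxx.
      - by apply: card_add_edge_le; rewrite -(cS _ _ vD wA).
    by rewrite lerD2l ler_wpM2l // deficit_weight_add ?ow.
  rewrite exchange_big /= sumr_const big_split /= sumr_const -mulr_sumr sumrB sumr_const -mulr_sumr.
  rewrite -deficit_weight_deficient -/W card_pair_edges // natrM.
  rewrite -(mulr_natl (_ + _)) -(mulr_natl eps) -(mulr_natl W).
  rewrite le_eqVlt; apply/orP; left; apply/eqP; ring.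
(* The hit probability is proportional to [#|E|] and the mean drop after a hit inversely so. Hence
   the number of deficient vertices cancels, and the rate does not degrade as they become few. *)
have key : kappa <= (1 - p) * (#|Av|%:R * tau / #|E|%:R).
  have cE' : (#|E| <= m * n)%N.
    rewrite card_pair_edges // leq_mul //; first by apply: leq_trans Um; apply/subset_leq_card/fintype.subsetP => x; rewrite inE => /andP[].
    by rewrite -[leqRHS]card_ord max_card.
  have h1 : (K * #|E|)%:R / ((K * (m * n))%:R + half_sq) <= 1 - p.
    rewrite ler_pdivrMr //.
    apply: le_trans (_ : _ <= (1 - p) * ((K * #|E|)%:R + half_sq)) _; first by lra.
    by rewrite ler_wpM2l ?subr_ge0 // lerD2r ler_nat leq_mul2l cE' orbT.
  have a0 : 0 <= #|Av|%:R * tau / #|E|%:R by rewrite divr_ge0 // mulr_ge0.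
  apply: le_trans (ler_wpM2r a0 h1); rewrite /kappa -/tau !natrM.
  apply: le_trans (_ : _ <= K%:R * #|Av|%:R * tau / (K%:R * (m%:R * n%:R) + n%:R * n%:R / 2)) _.
    move: (D0); rewrite !natrM => D1.
    apply: ler_wpM2r; first by rewrite invr_ge0 ltW.
    by rewrite ler_wpM2r // ler_wpM2l // ler_nat.
  rewrite le_eqVlt; apply/orP; left; apply/eqP.
  move: (lt0r_neq0 D0); rewrite !natrM.
  move: (K%:R * (m%:R * n%:R) + n%:R * n%:R / 2) => D Dn.
  by field; rewrite Dn lt0r_neq0.
have {hit}hit : (\sum_(e in E) loss (T0 + T) (e |: B)) / #|E|%:R <=
    eps + y * W - y * W * (#|Av|%:R * tau / #|E|%:R).
  rewrite ler_pdivrMr //; apply: le_trans hit _.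
  by rewrite le_eqVlt; apply/orP; left; apply/eqP; field; rewrite lt0r_neq0.
apply: le_trans (_ : _ <= p * (eps + y * W) + (1 - p) * (eps + y * W - y * W * (#|Av|%:R * tau / #|E|%:R))) _.
  by apply: lerD; apply: ler_wpM2l; rewrite ?subr_ge0.
have yW : 0 <= y * W by rewrite mulr_ge0 // (le_trans ler01).
have := ler_wpM2l yW key; move: (#|Av|%:R * tau / #|E|%:R) => r.
set z := y * W => h.
have -> : (1 - kappa) * y * W = z - z * kappa by rewrite /z; ring.
have -> : p * (eps + z) + (1 - p) * (eps + z - z * r) = eps + (z - z * ((1 - p) * r)) by ring.
by rewrite lerD2l lerD2l lerN2.
Qed.

End CollectAllLegs.

(** * Routing through the reserve *)

Section Expansion.
Variables (T : finType) (e : rel T) (A : {set T}) (k : nat).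
Hypotheses (k_gt0 : (0 < k)%N) (A_big : (5 * k <= #|A|)%N).
Hypothesis joined : forall J L : {set T}, J \subset A -> L \subset A -> [disjoint J & L] ->
  #|J| = k -> #|L| = k -> exists j l, [/\ j \in J, l \in L & e j l].

Definition boundary (X : {set T}) : {set T} := [set y in A :\: X | [exists x in X, e x y]].

(** Otherwise [k] vertices of [X] and [k] vertices not reached from [X] would contradict
    [joined]. *)
Lemma card_boundary (X : {set T}) : X \subset A -> (k <= #|X|)%N ->
  (#|A| < #|X| + #|boundary X| + k)%N.
Proof.
move=> XA kX; rewrite ltnNge; apply/negP => big.
have [J JX cJ] := exists_subset_card kX.
have bX : boundary X \subset A :\: X by apply/fintype.subsetP => y; rewrite inE => /andP[].
have [L LX cL] : exists2 L : {set T}, L \subset (A :\: X) :\: boundary X & #|L| = k.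
  apply: exists_subset_card; rewrite !cardsDS //.
  by move: big; lia.
have [|||j [l [jJ lL ejl]]] := joined (J := J) (L := L) _ _ _ cJ cL.
- exact: fintype.subset_trans JX XA.
- apply: fintype.subset_trans LX _; apply: fintype.subset_trans (finset.subsetDl _ _) _.
  exact: finset.subsetDl.
- apply/pred0P => z /=; apply/negP => /andP[/(fintype.subsetP JX) zX /(fintype.subsetP LX)].
  by rewrite !inE zX andbF.
have := fintype.subsetP LX l lL; rewrite finset.in_setD => /andP[/negP lb lAX]; apply: lb.
rewrite inE lAX; apply/existsP; exists j; rewrite ejl andbT; exact: (fintype.subsetP JX).
Qed.

(* All vertices but those of a small non-expanding set [S], chosen maximal, have
   balls that double until they reach size [k]; such a ball is adjacent to
   almost everything. *)
Lemma expansion (l : nat) : (k <= 2 ^ l)%N ->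
  exists2 S : {set T}, (#|S| < k)%N & forall x, x \in A :\: S ->
    exists2 Z : {set T}, Z \subset A /\ (#|A| < #|Z| + k)%N &
    forall y, y \in Z -> exists p, [/\ path e x p, last x p = y, uniq (x :: p),
      {subset p <= A} & (size p <= l.+1)%N].
Proof.
move=> kl.
pose small (S : {set T}) := [&& S \subset A, (#|S| <= 2 * k)%N & (#|boundary S| <= #|S|)%N].
have small0 : small finset.set0.
  rewrite /small finset.sub0set cards0 /= leqn0 cards_eq0; apply/eqP/setP => y.
  rewrite !inE /=; apply/negP => /andP[_ /existsP[x]]; by rewrite inE.
case: (@arg_maxnP _ finset.set0 small (fun S => #|S|) small0) => S /and3P[SA S2k bS] Smax.
(* A set [S] of size between [k] and [2 * k] would give [#|A| < 5 * k] by [card_boundary]; hence the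
   5 in [A_big]. *)
have Sk : (#|S| < k)%N.
  rewrite ltnNge; apply/negP => kS; have := card_boundary SA kS; move: A_big bS S2k; lia.
exists S => // x xAS.
(* A set [X] that does not expand outside [S] could be merged into [S], against maximality. *)
have expand (X : {set T}) : X \subset A :\: S -> (0 < #|X|)%N -> (#|X| <= k)%N ->
    (#|X| < #|boundary X :\: S|)%N.
  rewrite subsetD => /andP[XA dXS] X0 Xk; rewrite ltnNge; apply/negP => bX.
  have cU : #|S :|: X| = (#|S| + #|X|)%N.
    by rewrite cardsU (_ : S :&: X = finset.set0) ?cards0 ?subn0 //; apply/eqP; rewrite setI_eq0 disjoint_sym.
  suff /Smax : small (S :|: X) by rewrite /= cU; move: X0; lia.
  rewrite /small finset.subUset SA XA cU /=; apply/andP; split; first by move: Sk Xk; lia.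
  apply: leq_trans (_ : #|boundary S :|: (boundary X :\: S)| <= _)%N; last first.
    by apply: leq_trans (leq_card_setU _ _) _; apply: leq_add.
  apply/subset_leq_card/fintype.subsetP => y; rewrite !inE negb_or.
  case/andP=> /andP[/andP[yS yX] yA] /existsP[z /andP[]]; rewrite yS yX yA inE => /orP[zS|zX] ezy.
    by apply/orP; left; apply/existsP; exists z; rewrite zS.
  by apply/orP; right; apply/existsP; exists z; rewrite zX.
pose ball i := iter i (fun X => X :|: (boundary X :\: S)) [set x].
have ballS i : ball i.+1 = ball i :|: (boundary (ball i) :\: S) by [].
have ballA i : ball i \subset A :\: S.
  elim: i => [|i IH]; first by rewrite finset.sub1set.
  rewrite ballS finset.subUset IH /=; apply/fintype.subsetP => y; rewrite !inE.
  by case/andP=> -> /andP[/andP[_ ->]].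
have ball_path i y : y \in ball i -> exists p, [/\ path e x p, last x p = y,
    {subset p <= A} & (size p <= i)%N].
  elim: i y => [|i IH] y; first by rewrite inE => /eqP->; exists [::].
  rewrite ballS finset.in_setU => /orP[/IH[p [? ? ? ps]]|]; first by exists p; split=> //; apply: leqW.
  rewrite !inE => /andP[_ /andP[/andP[_ yA] /existsP[z /andP[/IH[p [pp pz pA ps]] ezy]]]].
  exists (rcons p y); rewrite rcons_path pp pz last_rcons size_rcons; split=> //.
  by move=> t; rewrite mem_rcons inE => /orP[/eqP->|/pA].
have ball_card i : (2 ^ i <= #|ball i|)%N || (k <= #|ball i|)%N.
  elim: i => [|i IH]; first by rewrite cards1.
  have sub : (#|ball i| <= #|ball i.+1|)%N by rewrite subset_leq_card // ballS finset.subsetUl.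
  have [kb|bk] := leqP k #|ball i|; first by rewrite (leq_trans kb sub) orbT.
  apply/orP; left; move: IH; rewrite [(k <= _)%N]leqNgt bk orbF => IH.
  have b0 : (0 < #|ball i|)%N by apply: leq_trans IH; rewrite expn_gt0.
  have := expand _ (ballA i) b0 (ltnW bk).
  rewrite ballS cardsU (_ : _ :&: _ = finset.set0) ?cards0 ?subn0; last first.
    by apply/setP => y; rewrite !inE; case: (y \in ball i); rewrite ?andbF.
  by rewrite expnS; move: IH; lia.
have kb : (k <= #|ball l|)%N by case/orP: (ball_card l) => // h; apply: leq_trans h.
have bA : ball l \subset A by apply: fintype.subset_trans (ballA l) (finset.subsetDl _ _).
exists (ball l :|: boundary (ball l)).
  split; first by rewrite finset.subUset bA; apply/fintype.subsetP => y; rewrite !inE => /andP[/andP[_ ->]].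
  rewrite cardsU (_ : _ :&: _ = finset.set0) ?cards0 ?subn0; first exact: card_boundary.
  by apply/setP => y; rewrite !inE; case: (y \in ball l); rewrite ?andbF.
move=> y yZ.
have [p [pp py pA ps]] : exists p, [/\ path e x p, last x p = y, {subset p <= A} & (size p <= l.+1)%N].
  move: yZ; rewrite finset.in_setU => /orP[/ball_path[p [? ? ? ps]]|].
    by exists p; split=> //; apply: leqW.
  rewrite !inE => /andP[/andP[_ yA] /existsP[z /andP[/ball_path[p [pp pz pA ps]] ezy]]].
  exists (rcons p y); rewrite rcons_path pp pz last_rcons size_rcons; split=> //.
  by move=> t; rewrite mem_rcons inE => /orP[/eqP->|/pA].
(* Shortening only deletes vertices, so the path stays in [A] and keeps the length bound. *)
rewrite -py; case/shortenP: pp => p' pp' up' sub.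
exists p'; split=> //; first by move=> z /sub/pA.
by apply: leq_trans ps; apply: uniq_leq_size; [case/andP: up' | move=> z /sub].
Qed.

End Expansion.

(** * Alternating paths through the reserve *)

Section Route.
Variable n : nat.

(** Grafting [g x] onto the first vertex [a] of the path moves the free vertex from [g x] to [g a].
    Repeating this brings it to [g (last x p)], where it is joined to [y]. Only the pairs met by the
    path, [g x] and [y] change. *)
Lemma route (B : graph n) (g : 'I_n -> 'I_n) p : involutive g -> forall f x y,
  matching B f -> (forall a, a \in p -> f a = g a) ->
  (forall a a', a \in p -> a' \in p -> g a != a') -> uniq p ->
  path (fun a a' => [set g a; a'] \in B) x p ->
  f (g x) = g x -> f y = y -> y != g x -> [set y; g (last x p)] \in B ->
  exists f', [/\ matching B f', unmatched f' = unmatched f :\ g x :\ y &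
    forall z, z \notin p -> g z \notin p -> z != g x -> z != y -> f' z = f z].
Proof.
move=> gK; elim: p => [|a p IH] f x y mf fp gp up pp fx fy yx e.
  have [fK _] := mf.
  exists (graft f (g x) y); split.
  - by apply: matching_graft => //; rewrite 1?eq_sym // setUC.
  - by rewrite unmatched_join // eq_sym.
  - by move=> z _ _ zx zy; rewrite graft_other // fy.
have [fK _] := mf.
move: up pp => /= /andP[ap up] /andP[xa pp].
have fa : f a = g a by apply: fp; rewrite inE eqxx.
have ga : g a != a by apply: gp; rewrite inE eqxx.
have fga : f (g a) = a by rewrite -fa fK.
have nfix z : f z = z -> z != a /\ z != g a.
  move=> fz; split; apply: contraNneq ga => za; first by rewrite -fa -za fz.
  by rewrite -[X in _ == X]fga -za fz.
have [gxa gxga] := nfix _ fx; have [ya yga] := nfix _ fy.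
have m1 : matching B (graft f (g x) a) by apply: matching_graft.
have f1ga : graft f (g x) a (g a) = g a by rewrite -fa graft_partner ?fa.
have keep z : z != g x -> z != a -> z != g a -> graft f (g x) a z = f z.
  by move=> zx za zga; rewrite graft_other // fa.
have ap' z : z \in p -> z != a by move=> zp; apply: contraNneq ap => <-.
have gz z : z \in p -> f z = g z /\ g z != z.
  by move=> zp; rewrite fp ?gp // inE zp orbT.
have [| | |f' [mf' uf' kf']] := IH (graft f (g x) a) a y m1 _ _ up pp f1ga _ yga e.
- move=> z zp; have [fz gzz] := gz z zp.
  rewrite keep ?ap' //; last by rewrite eq_sym; apply: gp; rewrite inE ?zp ?eqxx ?orbT.
  by apply: contraNneq gzz => zx; rewrite -fz zx fx.
- by move=> z z' zp zp'; apply: gp; rewrite inE ?zp ?zp' orbT.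
- by rewrite keep.
exists f'; split=> //.
  rewrite uf'; apply/setP => z; rewrite !finset.in_setD1 unmatched_graft //.
  rewrite fa; case: (eqVneq z y) => //= zy.
  case: (eqVneq z (g a)) => [->|zga] /=; first by rewrite inE fga (eq_sym a) (negPf ga) andbF.
  case: (eqVneq z (g x)) => //= zx; case: (eqVneq z a) => [->|//].
  by rewrite inE fa (negPf ga).
move=> z; rewrite !inE !negb_or => /andP[za zp] /andP[gza gzp] zx zy.
have zga : z != g a by apply: contraNneq gza => ->; rewrite gK.
by rewrite kf' // keep.
Qed.
End Route.

Section RoutePhase.
Variables (R : realType) (n K : nat) (G : pred (graph n)).
Hypothesis K_gt0 : (0 < K)%N.
Implicit Types (B X E : graph n) (f : 'I_n -> 'I_n) (o : 'I_n -> option 'I_n).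
Notation loss := (loss R K G).
Notation half_sq := ((n * n)%:R / 2 : R).

Variables (g : 'I_n -> 'I_n) (A : {set 'I_n}) (k l d m b : nat).
Hypotheses (gK : involutive g) (dA : [disjoint A & g @: A]).
Hypotheses (k_gt0 : (0 < k)%N) (kl : (k <= 2 ^ l)%N) (d_gt0 : (0 < d)%N).
Hypothesis (A_big : (5 * k + m * l.+1 <= #|A|)%N).
Hypothesis goodG : forall B, (#|B| <= b)%N -> has_matching B n./2 -> G B.

Let C : {set 'I_n} := A :|: g @: A.

Lemma reserveP x : (x \in C) = (x \in A) || (g x \in A).
Proof.
rewrite finset.in_setU; congr (_ || _); rewrite -{1}(gK x) mem_imset //; exact: inv_inj.
Qed.

Lemma reserve_disjoint x y : x \in A -> y \in A -> g x != y.
Proof.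
move=> xA yA; apply: contraTneq yA => <-; apply/negP => gxA.
by have := disjointFr dA gxA; rewrite imset_f.
Qed.

(* [Q] is the set of unmatched vertices not yet routed into the reserve [A] and
   [A'] the untouched part of the reserve. The last clause allows one vertex
   [g x] of the reserve to be unmatched, with [Z] the set of ends of alternating
   paths starting from it. *)
Definition route_state (q : nat) B : Prop := exists f o (Q A' : {set 'I_n}),
  [/\ matching B f, legs C B f o,
    [/\ #|Q| = q, Q \subset unmatched f,
      forall u, u \in Q -> (d <= #|legset o u|)%N & forall w u, o w = Some u -> u \in Q],
    [/\ A' \subset A, forall a, a \in A' -> f a = g a & (5 * k + q * l.+1 <= #|A'|)%N] &
    unmatched f = Q \/ exists x (Z : {set 'I_n}),
      [/\ x \in A, f (g x) = g x, g x \notin Q, unmatched f = g x |: Q &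
      [/\ Z \subset A, (4 * k <= #|Z|)%N & forall y, y \in Z -> exists p,
        [/\ path (fun a a' => [set g a; a'] \in B) x p, last x p = y, uniq p,
            {subset p <= A'} & (size p <= l.+1)%N]]]].

Let budget_drop q i s t : (i + s = t -> i <= l.+1 -> 5 * k + q.+1 * l.+1 <= t ->
  5 * k + q * l.+1 <= s)%N.
Proof. by move=> <- il; rewrite mulSn; lia. Qed.

(** Two kinds of step alternate. If no reserve vertex is free, an edge from a leg end [f w] to a
    well expanding [a] in the reserve shifts the free vertex from [u] to [g a]. If [g x] is free, an
    edge from [f w] to [g y] with [y] in [Z] closes an alternating path that matches both [g x] and
    [u]. Either way one vertex of [Q] and at most [l.+1] reserve pairs are spent. *)
Lemma route_step q B : linked g A k B -> route_state q.+1 B ->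
  exists E, [/\ E \subset complete_graph n, E != finset.set0,
    forall e, e \in E -> route_state q (e |: B) & (q.+1 * d * (4 * k) <= #|E|)%N].
Proof.
move=> lk [f [ o [Q [A' [mf lg [cQ QU Qd oQ] [A'A fA' cA'] last_clause]]]]].
have [fK _] := mf.
have cA5 : (5 * k <= #|A'|)%N by apply: leq_trans cA'; rewrite leq_addr.
pose Y := f @: leg_ends o Q.
have cY : (q.+1 * d <= #|Y|)%N.
  rewrite card_imset; last exact: inv_inj.
  by rewrite card_leg_ends -cQ -sum_nat_const; apply: leq_sum => u /Qd.
have YP y : y \in Y -> exists w u, [/\ y = f w, o w = Some u & u \in Q].
  move=> /imsetP[w]; rewrite inE; case ow: (o w) => [u|//] uQ ->; by exists w, u.
have YC (D : {set 'I_n}) : D \subset C -> [disjoint Y & D].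
  move=> DC; rewrite disjoint_sym; apply: disjointWl DC _; apply/pred0P => y /=.
  apply/negP => /andP[yC /YP[w [u [yE ow _]]]].
  by have [_ _ _ _ /andP[_]] := lg _ _ ow; rewrite -yE yC.
have E_ok (D : {set 'I_n}) : D \subset C -> (4 * k <= #|D|)%N ->
    (forall w u a, o w = Some u -> a \in D -> u \in Q -> route_state q ([set f w; a] |: B)) ->
    exists E, [/\ E \subset complete_graph n, E != finset.set0,
      forall e, e \in E -> route_state q (e |: B) & (q.+1 * d * (4 * k) <= #|E|)%N].
  move=> DC cD st; exists (pair_edges Y D); split.
  - exact: pair_edges_complete (YC D DC).
  - apply: pair_edges_neq0; first by apply: leq_trans cY; rewrite muln_gt0.
    by apply: leq_trans cD; rewrite muln_gt0.
  - by move=> _ /pair_edgesP[y [a [/YP[w [u [-> ow uQ]]] aD ->]]]; apply: (st w u).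
  - by rewrite card_pair_edges ?leq_mul //; apply: YC.
have gA' a : a \in A' -> g a != a.
  by move=> aA'; apply: reserve_disjoint; apply: (fintype.subsetP A'A).
have fixA' z a : f z = z -> a \in A' -> z != a /\ z != g a.
  move=> fz aA'; have ga := gA' a aA'; split; apply: contraNneq ga => za.
    by rewrite -fA' // -za fz.
  by have : f (g a) = a; [rewrite -fA' ?fK | rewrite -za fz => ->].
have legA' w u a : o w = Some u -> a \in A -> [/\ w != a, w != g a, f w != a & f w != g a].
  move=> ow aA; have [_ _ _ _] := lg _ _ ow; rewrite !reserveP !negb_or.
  move=> /andP[/andP[wA gwA] /andP[fwA gfwA]]; split.
  - by apply: contraNneq wA => ->.
  - by apply: contraNneq gwA => ->; rewrite gK.
  - by apply: contraNneq fwA => ->.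
  - by apply: contraNneq gfwA => ->; rewrite gK.
have moved w u B' : o w = Some u -> u \in Q -> B \subset B' ->
  let f1 := graft f u w in [/\ matching B' f1, f1 (f w) = f w,
    forall z, z != u -> z != w -> z != f w -> f1 z = f z,
    forall z, f z = z -> z != u -> [/\ f1 z = z, z != w & z != f w] &
    forall z, (z \in unmatched f1) = (z == f w) || (z != u) && (z \in unmatched f)].
  move=> ow uQ BB' f1; have [fu fw uw ofw _] := lg _ _ ow.
  have uw' : u != w by apply: contraNneq fw => <-; rewrite fu.
  have fz z : f z = z -> z != w /\ z != f w.
    move=> fz; have zw : z != w by apply: contraNneq fw => <-; rewrite fz.
    by split=> //; apply: contraNneq zw => zfw; rewrite -fz zfw fK.
  split.
  - by apply: matching_graft => //; [apply: matching_sub mf | apply: (fintype.subsetP BB')].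
  - exact: graft_partner.
  - by move=> z zu zw zfw; apply: graft_other.
  - by move=> z fzz zu; have [zw zfw] := fz z fzz; split=> //; rewrite /f1 graft_other.
  - move=> z; rewrite unmatched_graft //.
    case: (eqVneq z (f w)) => [->|zfw] /=.
      by rewrite fw; have [_] := fz u fu; rewrite eq_sym => ->.
    by case: (eqVneq z u) => //= zu; case: (eqVneq z w) => [->|//]; rewrite inE (negPf fw).
have legs_moved w u B' f' : o w = Some u -> u \in Q -> B \subset B' ->
    (forall x v, o x = Some v -> v \in Q -> v != u -> x != w -> x != f w ->
      f' v = v /\ f' x = f x) ->
    [/\ legs C B' f' (drop_legs o [set u]),
      forall v, v \in Q :\ u -> (d <= #|legset (drop_legs o [set u]) v|)%N &
      forall x v, drop_legs o [set u] x = Some v -> v \in Q :\ u].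
  move=> ow uQ BB' h; have [fu fw uw ofw _] := lg _ _ ow; split.
  - apply: (legs_drop (legs_sub BB' lg)) => x v ox; rewrite inE => vu.
    apply: (h x v) => //; first exact: oQ ox.
    + by apply: contraNneq vu => xw; move: ox; rewrite xw ow => -[->].
    + by apply/eqP => xw; rewrite xw ofw in ox.
  - by move=> v; rewrite !inE => /andP[vu vQ]; rewrite legset_drop ?inE // Qd.
  - by move=> x v /drop_legsP[ox]; rewrite !inE => ->; rewrite (oQ x).
case: last_clause => [UQ|[x [Z [xA fgx gxQ UQ [ZA cZ Zp]]]]].
  have [||S cS Sp] := @expansion _ (fun a a' => [set g a; a'] \in B) A' k k_gt0 _ _ l kl.
  - exact: cA5.
  - by move=> J L JA LA; apply: lk; apply: fintype.subset_trans A'A.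
  apply: (E_ok (A' :\: S)).
  - apply: fintype.subset_trans (finset.subsetDl _ _) _; apply: fintype.subset_trans A'A _; exact: finset.subsetUl.
  - have arith t s i y : (5 * k <= t -> s < k -> i <= s -> i + y = t -> 4 * k <= y)%N by lia.
    exact: arith cA5 cS (subset_leq_card (finset.subsetIr A' S)) (cardsID S A').
  move=> w u a ow aD uQ; have [Z [ZA' cZ] Zp] := Sp a aD.
  have aA' : a \in A' by move: aD; rewrite !inE => /andP[].
  have aA := fintype.subsetP A'A a aA'.
  set B' := [set f w; a] |: B; have BB' : B \subset B' by apply: finset.subsetUr.
  have [m1 f1fw keep1 fix1 U1] := moved w u B' ow uQ BB'.
  have [fu fw uw ofw wC] := lg _ _ ow.
  have [wa wga fwa fwga] := legA' _ _ _ ow aA.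
  have [ua uga] := fixA' u a fu aA'.
  set f1 := graft f u w in m1 f1fw keep1 fix1 U1.
  have [f1K _] := m1.
  have f1a : f1 a = g a by rewrite -(fA' a aA'); apply: keep1; rewrite eq_sym.
  have keep z : z != u -> z != w -> z != f w -> z != a -> z != g a ->
      graft f1 (f w) a z = f z.
    by move=> zu zw zfw za zga; rewrite graft_other ?f1a // keep1.
  have m2 : matching B' (graft f1 (f w) a) by apply: matching_graft; rewrite // finset.setU11.
  have fixed2 z : f z = z -> z != u -> graft f1 (f w) a z = z.
    move=> fz zu; have [_ zw zfw] := fix1 z fz zu; have [za zga] := fixA' z a fz aA'.
    by rewrite keep.
  have [|l2 Qd2 oQ2] := legs_moved w u B' (graft f1 (f w) a) ow uQ BB'.
    move=> z v oz vQ vu zw zfw; have [fv fz _ _ _] := lg _ _ oz.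
    have [za zga _ _] := legA' _ _ _ oz aA.
    by split; [apply: fixed2 | apply: keep => //; apply: contraNneq fz => ->; rewrite fu].
  exists (graft f1 (f w) a), (drop_legs o [set u]), (Q :\ u), (A' :\ a); split=> //.
  - split=> //; first by move: cQ; rewrite (cardsD1 u) uQ => -[].
    apply/fintype.subsetP => z; rewrite !inE => /andP[zu zQ]; apply/eqP/fixed2 => //.
    by apply/eqP; have := fintype.subsetP QU z zQ; rewrite inE.
  - split.
    + by apply: fintype.subset_trans (finset.subsetDl _ _) A'A.
    + move=> z; rewrite !inE => /andP[za zA'].
      have zA := fintype.subsetP A'A z zA'.
      have [uz _] := fixA' u z fu zA'; have [wz _ fwz _] := legA' _ _ _ ow zA.
      by rewrite -(fA' z zA'); apply: keep; rewrite // eq_sym //; apply: reserve_disjoint.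
    + by apply: budget_drop cA'; [apply/esym; rewrite (cardsD1 a A') aA' |].
  (* [Z] was found before [a] left the untouched reserve; its paths start at [a] and are simple, so
     they avoid [a] afterwards. *)
  right; exists a, Z; split=> //.
  - by rewrite -{1 2}f1a graft_partner // f1a gA'.
  - rewrite !inE negb_and negbK; apply/orP; right; apply/negP => /(fintype.subsetP QU).
    by rewrite inE => /eqP/fixA'/(_ aA')[_]; rewrite eqxx.
  - apply/setP => z; rewrite unmatched_graft // U1 f1a !inE.
    case: (eqVneq z (g a)) => [->|zga] /=; first by rewrite gA' // eq_sym fwga.
    case: (eqVneq z (f w)) => [->|zfw] /=.
      by rewrite -UQ inE fK (eq_sym w) (negPf fw) andbF.
    case: (eqVneq z a) => [->|za] /=; last by rewrite -UQ inE.
    by rewrite -UQ inE fA' // (negPf (gA' a aA')) andbF.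
  - split; first by apply: fintype.subset_trans A'A.
    + have arith t z : (5 * k <= t -> t < z + k -> 4 * k <= z)%N by clear; lia.
      exact: arith cA5 cZ.
    move=> y /Zp[p [pp py up pA' ps]]; exists p; split=> //.
    + by apply: sub_path pp => z z'; apply: (fintype.subsetP BB').
    + by case/andP: up.
    + by move=> z zp; rewrite !inE pA' // andbT; case/andP: up => /negP ap _; apply/eqP => za; apply: ap; rewrite -za.
apply: (E_ok (g @: Z)).
- apply: fintype.subset_trans (imsetS g ZA) _; exact: finset.subsetUr.
- by rewrite card_imset //; apply: inv_inj.
move=> w u _ ow /imsetP[y yZ ->] uQ.
have [p [pp py up pA' ps]] := Zp y yZ.
set B' := [set f w; g y] |: B; have BB' : B \subset B' by apply: finset.subsetUr.
have [m1 f1fw keep1 fix1 U1] := moved w u B' ow uQ BB'.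
have [fu fw uw ofw wC] := lg _ _ ow.
set f1 := graft f u w in m1 f1fw keep1 fix1 U1.
have gxu : g x != u by apply: contraNneq gxQ => ->.
have [f1gx gxw gxfw] := fix1 _ fgx gxu.
have pA z : z \in p -> z \in A by move=> /pA'; apply: (fintype.subsetP A'A).
have f1A' z : z \in A' -> f1 z = g z.
  move=> zA'; have [uz _] := fixA' u z fu zA'.
  have [wz _ fwz _] := legA' _ _ _ ow (fintype.subsetP A'A z zA').
  by rewrite -(fA' z zA'); apply: keep1; rewrite eq_sym.
have [|||||f' [m2 U2 keep2]] := @route n B' g p gK f1 x (f w) m1 _ _ up _ f1gx f1fw _ _.
- by move=> z /pA'; apply: f1A'.
- by move=> z z' /pA zA /pA; apply: reserve_disjoint.
- by apply: sub_path pp => z z'; apply: (fintype.subsetP BB').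
- by rewrite eq_sym.
- by rewrite py finset.setU11.
have fixed2 z : f z = z -> z != u -> z \in Q -> f' z = z.
  move=> fz zu zQ; have [f1z zw zfw] := fix1 z fz zu; rewrite keep2 ?f1z //.
  - by apply/negP => /pA'/(fixA' _ _ fz)[]; rewrite eqxx.
  - by apply/negP => /pA'/(fixA' _ _ fz)[_]; rewrite gK eqxx.
  - by apply: contraNneq gxQ => <-.
have [|l2 Qd2 oQ2] := legs_moved w u B' f' ow uQ BB'.
  move=> z v oz vQ vu zw zfw; have [fv fz _ _ _] := lg _ _ oz.
  split; first exact: fixed2.
  have [_ zgx _ _] := legA' _ _ _ oz xA.
  have zu : z != u by apply: contraNneq fz => ->; rewrite fu.
  rewrite keep2 ?keep1 //; apply/negP => /pA/(legA' _ _ _ oz)[].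
    by rewrite eqxx.
  by rewrite gK eqxx.
exists f', (drop_legs o [set u]), (Q :\ u), (A' :\: [set z in p]); split=> //.
- split=> //; first by move: cQ; rewrite (cardsD1 u) uQ => -[].
  apply/fintype.subsetP => z; rewrite !inE => /andP[zu zQ]; apply/eqP/fixed2 => //.
  by apply/eqP; have := fintype.subsetP QU z zQ; rewrite inE.
- split.
  + by apply: fintype.subset_trans (finset.subsetDl _ _) A'A.
  + move=> z; rewrite !inE => /andP[zp zA'].
    have zA := fintype.subsetP A'A z zA'.
    have [_ _ fwz _] := legA' _ _ _ ow zA.
    rewrite keep2 ?f1A' // 1?eq_sym //; last exact: reserve_disjoint.
    by apply/negP => /pA gzA; have := reserve_disjoint zA gzA; rewrite eqxx.
  + apply: budget_drop (cardsID [set z in p] A') _ cA'.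
    apply: leq_trans (subset_leq_card (finset.subsetIr _ _)) _.
    by apply: leq_trans ps; rewrite cardsE card_size.
left; rewrite U2; apply/setP => z; rewrite !finset.in_setD1 U1 UQ !inE.
case: (eqVneq z (f w)) => [->|zfw] /=.
  apply/esym/negP => /andP[_ /(fintype.subsetP QU)].
  by rewrite inE fK (eq_sym w) (negPf fw).
by case: (eqVneq z (g x)) => [->|zx] //=; rewrite (negPf gxQ) andbF.
Qed.

(** The number of useful edges is proportional to the number of vertices still to be routed, hence
    the harmonic sum. At the end at most one displaced reserve vertex is free, which a matching of
    size [n./2] allows. *)
Lemma route_phase B f o F :
  matching B f -> f =1 g -> legs C B f o -> (#|unmatched f| = m)%N -> linked g A k B ->
  (forall u, u \in unmatched f -> (d <= #|legset o u|)%N) -> (#|B| + m <= b)%N ->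
  loss (m + F) B <= half_sq / (K * (d * (4 * k)))%:R *
    (\sum_(i < m) i.+1%:R^-1) / F.+1%:R.
Proof.
move=> mf fg lg cU lk Ud Bb.
pose a : R := half_sq / (K * (d * (4 * k)))%:R.
have Kd : 0 < (K * (d * (4 * k)))%:R :> R by rewrite ltr0n !muln_gt0 K_gt0 d_gt0 k_gt0.
have a0 : 0 <= a by rewrite divr_ge0 // half_sq_ge0.
pose P q B := [/\ linked g A k B, route_state q B & (#|B| + q <= b)%N].
have := @greedy_phase R n K G K_gt0 P (fun q => a * \sum_(i < q) i.+1%:R^-1) 0%N 0 (lexx 0) _ _ _ m F B.
rewrite !add0r; apply=> {F}.
- by move=> c; rewrite mulr_ge0 // sumr_ge0 // => i _; rewrite invr_ge0.
- by move=> c; rewrite ler_wpM2l // big_ord_recr /= lerDl invr_ge0.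
- move=> [|q] {mf lk Bb lg}B [lk st Bb].
    left; suff GB : G B by rewrite /= GB.
    have [f1 [ o1 [Q [A' [mf _ [cQ _ _ _] _ h]]]]] := st.
    rewrite addn0 in Bb; apply: goodG => //; apply: (has_matching_unmatched mf).
    have Q0 : Q = finset.set0 by apply/eqP; rewrite -cards_eq0 cQ.
    by case: h => [->|[x [Z [_ _ _ -> _]]]]; rewrite Q0 ?cards0 // finset.setU0 cards1.
  right; have [E [EC E0 Est cE]] := route_step lk st.
  exists q, E; split=> // [e eE|].
    split; last by have := @card_add_edge_le n e B q 0 b; rewrite !addn0; apply.
      by move=> J L JA LA JL cJ cL; have [j [z [jJ zL ez]]] := lk J L JA LA JL cJ cL; exists j, z; split=> //; rewrite inE ez orbT.
    exact: Est.
  rewrite big_ord_recr /= -mulrBr addrAC subrr add0r /a.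
  rewrite -[half_sq / _ * _]mulrA mulrCA ler_peMr ?half_sq_ge0 //.
  rewrite -invfM -natrM ler_pdivlMr ?mul1r; last by rewrite ltr0n !muln_gt0 K_gt0 d_gt0 k_gt0.
  rewrite ler_nat -mulnA leq_mul2l; apply/orP; right; apply: leq_trans cE.
  by rewrite mulnC !mulnA.
split=> //; exists f, o, (unmatched f), A; split=> //; last by left.
by split=> // w u /lg[fu _ _ _ _]; rewrite inE fu.
Qed.

End RoutePhase.

(** * Composition of the phases *)

Section AllPhases.
Variables (R : realType) (n K : nat) (G : pred (graph n)).
Hypothesis K_gt0 : (0 < K)%N.
Implicit Types (B X E : graph n) (f : 'I_n -> 'I_n) (o : 'I_n -> option 'I_n).
Notation loss := (loss R K G).
Notation half_sq := ((n * n)%:R / 2 : R).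

(** Keeping the smaller vertex of each matched pair selects one endpoint per pair. *)
Lemma exists_reserve f N : involutive f -> (2 * N + #|unmatched f| <= n)%N ->
  exists A : {set 'I_n}, #|A| = N /\ [disjoint A & f @: A].
Proof.
move=> fK Nn; pose L := [set x : 'I_n | (x < f x)%N].
have fI : injective f := inv_inj fK.
have sub : [set: 'I_n] \subset unmatched f :|: (L :|: f @: L).
  apply/fintype.subsetP => x _; rewrite !inE.
  have -> : (x \in f @: L) = (f x < x)%N by rewrite -{1}(fK x) mem_imset // inE fK.
  by rewrite -val_eqE /=; case: ltngtP.
have cL : (n <= #|unmatched f| + 2 * #|L|)%N.
  have := subset_leq_card sub; rewrite cardsT card_ord => /leq_trans; apply.
  apply: leq_trans (leq_card_setU _ _) _; rewrite leq_add2l.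
  by apply: leq_trans (leq_card_setU _ _) _; rewrite card_imset // mul2n addnn.
have [A AL cA] : exists2 A : {set 'I_n}, A \subset L & #|A| = N.
  apply: exists_subset_card; rewrite -(leq_pmul2l (ltn0Sn 1)).
  by move: (leq_trans Nn cL); rewrite addnC leq_add2l.
exists A; split=> //; apply/pred0P => x /=; apply/negP => /andP[xA /imsetP[y yA xy]].
have := fintype.subsetP AL x xA; have := fintype.subsetP AL y yA.
by rewrite !inE xy fK => h1 h2; have := ltn_trans h1 h2; rewrite ltnn.
Qed.

Lemma half_le u c : (u./2 = c)%N -> (u <= 2 * c + 1)%N.
Proof. by move=> <-; lia. Qed.

Variables (c0 c1 d2 N k l d S3 av b F T4 : nat) (theta : R).
Hypotheses (c1_gt0 : (0 < c1)%N) (d2_gt0 : (0 < d2)%N) (k_gt0 : (0 < k)%N) (d_gt0 : (0 < d)%N).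
Hypotheses (kl : (k <= 2 ^ l)%N) (c10 : (c1 <= c0)%N) (c0n : (c0 <= n./2)%N) (th1 : 1 <= theta).
Let m0 := (2 * c0 + 1)%N.
Let m := (2 * c1 + 1)%N.
Hypotheses (m0n : (2 * (m0 + 2 * (m0 * d2)) <= n)%N) (Nn : (2 * N + m <= n)%N).
Hypotheses (avn : (m + 2 * (m * d) + 2 * (2 * N) + av <= n)%N).
Hypotheses (N_big : (5 * k + m * l.+1 <= N)%N).
Hypothesis b_big : ((n./2 - c0) + m0 * d2 + (c0 - c1) + S3 + m * d + m <= b)%N.
Hypothesis goodG : forall B, (#|B| <= b)%N -> has_matching B n./2 -> G B.

Let d5 : R := half_sq / (K * (d * (4 * k)))%:R * (\sum_(i < m) i.+1%:R^-1) / F.+1%:R.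
Let kappa : R := (K * av)%:R * (1 - theta^-1) / ((K * (m * n))%:R + half_sq).
Let d4 : R := (1 - kappa) ^+ T4 * (m%:R * theta ^+ d).
Let d3 : R := (4 ^ N)%:R * (1 - (k ^ 2)%:R / (N ^ 2)%:R) ^+ S3
        + S3%:R * (half_sq / (K * k ^ 2)%:R) / F.+1%:R.
Let d2b : R := half_sq / (K * d2)%:R / c1%:R / F.+1%:R.
Let d2a : R := (m0 * d2)%:R * (n%:R / K%:R / c1%:R) / F.+1%:R.
Let d1 : R := half_sq / K%:R / c0%:R / F.+1%:R.

(** The [eps] of each phase is the bound already available for the later ones, and its [S] is the
    number of edges they may still add. Five phases have [F] spare rounds each; the phase collecting
    all legs has [T4] rounds altogether. *)
Lemma all_phases_loss :
  loss (m + F + T4 + S3 + F + (c0 - c1) + F + m0 * d2 + F + (n./2 - c0) + F) (finset.set0 : graph n)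
  <= d5 + d4 + d3 + d2b + d2a + d1.
Proof.
have m_gt0 : (0 < m)%N by rewrite /m addn1.
have d5_ge0 : 0 <= d5.
  apply: divr_ge0 => //; apply: mulr_ge0; first by rewrite divr_ge0 // half_sq_ge0.
  by apply: sumr_ge0 => i _; rewrite invr_ge0.
have n_gt0 : (0 < n)%N by apply: leq_trans avn; rewrite -!addnA ltn_addr.
have D0 : 0 < (K * (m * n))%:R + half_sq.
  by apply: ltr_pwDl; rewrite ?half_sq_ge0 // ltr0n !muln_gt0 K_gt0 m_gt0.
have kappa_le1 : 0 <= 1 - kappa.
  rewrite subr_ge0 ler_pdivrMr // mul1r.
  apply: le_trans (_ : _ <= (K * av)%:R * 1) _.
    by rewrite ler_wpM2l // gerBl invr_ge0 (le_trans ler01).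
  rewrite mulr1; apply: le_trans (_ : _ <= (K * (m * n))%:R) _; last by rewrite lerDl half_sq_ge0.
  rewrite ler_nat leq_mul2l; apply/orP; right; apply: (@leq_trans n); last by rewrite leq_pmull.
  by apply: leq_trans avn; exact: leq_addl.
have d4_ge0 : 0 <= d4.
  by rewrite mulr_ge0 ?exprn_ge0 // mulr_ge0 // exprn_ge0 // (le_trans ler01).
have kN : (k <= N)%N by apply: leq_trans N_big; rewrite mulSn -!addnA leq_addr.
have d3_ge0 : 0 <= d3.
  apply: addr_ge0.
    rewrite mulr_ge0 // exprn_ge0 // subr_ge0 ler_pdivrMr ?mul1r ?ler_nat ?leq_sqr //.
    by rewrite ltr0n expn_gt0 (leq_trans k_gt0 kN).
  by rewrite divr_ge0 // mulr_ge0 // divr_ge0 // half_sq_ge0.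
have d2b_ge0 : 0 <= d2b by rewrite !divr_ge0.
have d2a_ge0 : 0 <= d2a by rewrite divr_ge0 // mulr_ge0 // !divr_ge0.
have e4 : 0 <= d5 + d4 by exact: addr_ge0.
have e3 : 0 <= d5 + d4 + d3 by exact: addr_ge0.
have e2b : 0 <= d5 + d4 + d3 + d2b by exact: addr_ge0.
have e2a : 0 <= d5 + d4 + d3 + d2b + d2a by exact: addr_ge0.
have b1 : (0 + (n./2 - c0) + (m0 * d2 + ((c0 - c1) + (S3 + (m * d + m)))) <= b)%N.
  by rewrite add0n; apply: leq_trans b_big; rewrite -!addnA.
have id_matching : matching (finset.set0 : graph n) id.
  by split=> // x; rewrite eqxx.
have c0_gt0 : (0 < c0)%N by apply: leq_trans c10.
have Uid : (#|unmatched (id : 'I_n -> 'I_n)|./2 = c0 + (n./2 - c0))%N.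
  rewrite (_ : unmatched id = [set: 'I_n]) ?cardsT ?card_ord ?subnKC //.
  by apply/setP => x; rewrite !inE eqxx.
rewrite -(cards0 (Finite.clone _ {set 'I_n})) in b1.
apply: (greedy_matching_phase K_gt0 c0_gt0 _ _ F id_matching Uid b1); first exact: e2a.
move=> B1 f1 mf1 cf1 Bb1; have [f1K _] := mf1.
apply: (collect_most_legs_phase (S := (c0 - c1) + (S3 + (m * d + m))) (b := b) K_gt0 c1_gt0 _ f1K (half_le cf1) m0n _ F mf1).
- exact: e2b.
- move=> B2 o2 mf2 lg2 def2 Bb2.
  have cf1' : (#|unmatched f1|./2 = c1 + (c0 - c1))%N by rewrite cf1 subnKC.
  apply: (merge_legs_phase (S := S3 + (m * d + m)) (b := b) K_gt0 c1_gt0 d2_gt0 _ _ F mf2 lg2 def2 cf1').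
  + exact: e3.
  + move=> B3 f mf cf Bb3; have [fK _] := mf.
    have Um := half_le cf; rewrite -/m in Um.
    have [|A [cA dA]] := @exists_reserve f N fK.
      by apply: leq_trans Nn; rewrite leq_add2l.
    have kA : (k <= #|A|)%N by rewrite cA.
    rewrite /d3 [leRHS]addrA -cA.
    apply: (@link_reserve_phase R n K G K_gt0 (m + F + T4) (d5 + d4) k (m * d + m) b f A k_gt0 kA _ dA fK _ F S3 B3 mf).
    * exact: e4.
    * move=> B4 mf4 lk4 Bb4.
      apply: (@collect_all_legs_phase R n K G K_gt0 (m + F) d5 theta d k m m b av f A (A :|: f @: A)) => //.
      - rewrite cardsU (_ : _ :&: _ = finset.set0) ?cards0 ?subn0; last by apply/eqP; rewrite setI_eq0.
        by rewrite card_imset ?cA ?addnn -?mul2n //; apply: inv_inj.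
      - move=> B5 o mf5 lk5 lg5 dl5 Bb5.
        apply: le_trans (_ : _ <= loss (#|unmatched f| + F) B5) _.
          by apply: loss_mono; rewrite leq_add2r.
        apply: le_trans (@route_phase R n K G K_gt0 f A k l d #|unmatched f| b fK dA k_gt0 kl d_gt0 _ goodG B5 f o F mf5 (frefl f) lg5 erefl lk5 dl5 _) _.
        + by rewrite cA; apply: leq_trans N_big; rewrite leq_add2l leq_mul2r Um orbT.
        + by apply: leq_trans Bb5; rewrite leq_add2l.
        + rewrite /d5 ler_wpM2r ?invr_ge0 // ler_wpM2l ?divr_ge0 ?half_sq_ge0 //.
          rewrite -(subnKC Um) big_split_ord /= lerDl.
          by apply: sumr_ge0 => i _; rewrite invr_ge0.
      - by rewrite -addnA.
    * by rewrite -addnA in Bb3 *.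
  + by rewrite -addnA in Bb2 *.
- by rewrite -addnA in Bb1 *.
Qed.

End AllPhases.

(** * Asymptotics *)

Section PhaseSizes.
Variables (n s : nat).
Hypotheses (s_big : (1000 <= s)%N) (n_big : (s ^ 27 <= n)%N).
Let g := (n %/ s ^ 26)%N.

Let s_gt0 : (0 < s)%N. Proof. by apply: leq_trans s_big. Qed.

Lemma pow_gap i j : (i < j)%N -> (1000 * s ^ i <= s ^ j)%N.
Proof.
move=> ij; apply: (@leq_trans (s ^ i.+1)); first by rewrite expnS leq_mul2r s_big orbT.
by rewrite leq_pexp2l.
Qed.

Lemma unit_gap i j : (i < j)%N -> (1000 * (g * s ^ i) <= g * s ^ j)%N.
Proof. by move=> ij; rewrite mulnCA leq_mul2l pow_gap ?orbT. Qed.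

Lemma unit_ge : (s <= g)%N.
Proof. by rewrite leq_divRL ?expn_gt0 ?s_gt0 // -expnS. Qed.

Lemma pow_unit i : (1000 * s ^ i <= g * s ^ i)%N.
Proof. by rewrite leq_mul2r (leq_trans s_big unit_ge) orbT. Qed.

Lemma unit_le : (g * s ^ 26 <= n)%N.
Proof. exact: leq_trunc_div. Qed.

Lemma unit_lt : (n <= 2 * (g * s ^ 26))%N.
Proof.
have := ltn_ceil n (_ : 0 < s ^ 26)%N; rewrite expn_gt0 s_gt0 => /(_ isT)/ltnW/leq_trans; apply.
rewrite mulnA leq_mul2r; apply/orP; right; rewrite -/g.
by have := leq_trans s_big unit_ge; lia.
Qed.

(** Sizes are [g] times powers of [s], so one more factor [s] absorbs every numerical constant. [S3]
    is three times [s ^ 2 * N], since an added edge links a proportion of about [1 / s^2] of the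
    unlinked pairs. [r] bounds the number of vertices barred from new legs. *)
Lemma phase_sizes :
  let c0 := (g * s ^ 8)%N in let c1 := g in let d2 := (s ^ 8)%N in
  let N := (g * s ^ 22)%N in let k := (g * s ^ 21)%N in let d := (s ^ 9)%N in
  let S3 := (3 * (g * s ^ 24))%N in let m0 := (2 * c0 + 1)%N in let m := (2 * c1 + 1)%N in
  let r := (m + 2 * (m * d) + 2 * (2 * N))%N in
  [/\ (c1 <= c0)%N, (c0 <= n./2)%N, (2 * (m0 + 2 * (m0 * d2)) <= n)%N, (2 * N + m <= n)%N &
   [/\ (5 * k + m * (s ^ 21) <= N)%N, (r + (n - r) <= n)%N, (s * r <= n)%N,
    ((n./2 - c0) + m0 * d2 + (c0 - c1) + S3 + m * d + m <= n./2 + 5 * (g * s ^ 24))%N &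
    (m0 * d2 <= 3 * (g * s ^ 16))%N /\ (m <= 3 * g)%N]].
Proof.
cbv zeta.
set m0 := (2 * (g * s ^ 8) + 1)%N; set m := (2 * g + 1)%N.
have gs := unit_ge.
have h8 : (1000 * g <= g * s ^ 8)%N by have := @unit_gap 0 8 isT; rewrite muln1.
have h9 := @unit_gap 8 9 isT.
have h16 := @unit_gap 9 16 isT.
have h21 := @unit_gap 16 21 isT.
have h22 := @unit_gap 21 22 isT.
have h24 := @unit_gap 22 24 isT.
have h25 := @unit_gap 24 25 isT.
have h26 := @unit_gap 25 26 isT.
have nl := unit_le.
have p8 := pow_unit 8; have p9 := pow_unit 9; have p21 := pow_unit 21.
have m0d : (m0 * s ^ 8 = 2 * (g * s ^ 16) + s ^ 8)%N.
  by rewrite /m0 mulnDl mul1n -mulnA -(mulnA g) -expnD.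
have md : (m * s ^ 9 = 2 * (g * s ^ 9) + s ^ 9)%N by rewrite /m mulnDl mul1n mulnA.
have ml : (m * s ^ 21 = 2 * (g * s ^ 21) + s ^ 21)%N by rewrite /m mulnDl mul1n mulnA.
have s23 : (s * (g * s ^ 22) = g * s ^ 23)%N by rewrite mulnCA -expnS.
have h23 := @unit_gap 23 24 isT.
rewrite !m0d !md !ml.
have mE : m = (2 * g + 1)%N by [].
have m0E : m0 = (2 * (g * s ^ 8) + 1)%N by [].
have rle : (m + 2 * (2 * (g * s ^ 9) + s ^ 9) + 2 * (2 * (g * s ^ 22)) <= 5 * (g * s ^ 22))%N.
  by rewrite mE; move: gs s_big h8 h9 h16 h21 h22 p9; clear; lia.
have rs : (s * (m + 2 * (2 * (g * s ^ 9) + s ^ 9) + 2 * (2 * (g * s ^ 22))) <= n)%N.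
  apply: leq_trans (_ : s * (5 * (g * s ^ 22)) <= _)%N; first by rewrite leq_mul2l rle orbT.
  by rewrite mulnCA s23; move: h23 h25 h26 nl; clear; lia.
have rn : (m + 2 * (2 * (g * s ^ 9) + s ^ 9) + 2 * (2 * (g * s ^ 22)) <= n)%N.
  by apply: leq_trans rle _; move: h24 h25 h26 nl; clear; lia.
have hn : (g * s ^ 8 <= n./2)%N.
  rewrite geq_half_double -mul2n; apply: leq_trans nl.
  by apply: leq_trans (@unit_gap 8 26 isT); rewrite leq_mul2r orbT.
have x0 := @unit_gap 0 24 isT; have x8 := @unit_gap 8 24 isT.
have x9 := @unit_gap 9 24 isT; have x16 := @unit_gap 16 24 isT.
have x22 := @unit_gap 22 26 isT; have x16' := @unit_gap 16 26 isT.
have x8' := @unit_gap 8 16 isT; rewrite muln1 in x0.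
have x22' := @unit_gap 8 22 isT.
move: {hn}(n./2) hn => hf hn.
have g1 : (1 <= g)%N by apply: leq_trans gs.
move: g1 p8 p9 p21 h8 x0 x8 x9 x16 x22 x16' x8' x22' h22 nl rn rs hn; rewrite /m0 /m.
move: (g * s ^ 8)%N (g * s ^ 9)%N (g * s ^ 16)%N (g * s ^ 21)%N (g * s ^ 22)%N (g * s ^ 24)%N (g * s ^ 26)%N.
move: (s ^ 8)%N (s ^ 9)%N (s ^ 21)%N g => e8 e9 e21 g0 y8 y9 y16 y21 y22 y24 y26.
clear=> g1 p8 p9 p21 h8 x0 x8 x9 x16 x22 x16' x8' x22' h22 nl rn rs hn.
split=> //; try lia.
split=> //; try lia.
Qed.

End PhaseSizes.

(** * Error terms of the phases *)

Section Estimates.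
Variable R : realType.

Lemma harmonic_sum_le (m : nat) : (0 < m)%N -> \sum_(i < m) i.+1%:R^-1 <= 1 + ln m%:R :> R.
Proof.
elim: m => [//|[|m] IH] _; first by rewrite big_ord1 invr1 ln1 addr0.
rewrite big_ord_recr /=; apply: le_trans (lerD (IH isT) (lexx _)) _.
rewrite -addrA lerD2l -lerBrDl.
have p1 : 0 < m.+1%:R :> R by []. have p2 : 0 < m.+2%:R :> R by [].
have h1 : -1 < - m.+2%:R^-1 :> R by rewrite ltrN2 invf_lt1 // ltr1n.
have := le_ln1Dx h1; have -> : 1 - m.+2%:R^-1 = m.+1%:R / m.+2%:R :> R.
  by rewrite -[m.+2%:R]natr1; move: (m.+1%:R : R) p1 => p p1; field; rewrite lt0r_neq0 ?addr_gt0.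
by rewrite ln_div ?posrE // lerNr opprB.
Qed.

Lemma bernoulli_sub (x : R) j : 0 <= x <= 1 -> 1 - j%:R * x <= (1 - x) ^+ j.
Proof.
move=> /andP[x0 x1]; elim: j => [|j IH]; first by rewrite mul0r subr0 expr0.
rewrite exprS; apply: le_trans (_ : _ <= (1 - x) * (1 - j%:R * x)) _; last first.
  by rewrite ler_wpM2l // subr_ge0.
have -> : (1 - x) * (1 - j%:R * x) = 1 - (j%:R + 1) * x + j%:R * x * x by ring.
by rewrite natr1 lerDl !mulr_ge0.
Qed.

Lemma expR1_ge2 : 2 <= expR 1 :> R.
Proof. by have := expR_ge1Dx (1 : R); rewrite -natr1. Qed.

Variables (n s K : nat).
Hypotheses (s_big : (1000 <= s)%N) (n_big : (s ^ 27 <= n)%N) (K_gt0 : (0 < K)%N).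
Let g := (n %/ s ^ 26)%N.
Let X : R := s%:R.
Let Y : R := n%:R.
Let Gr : R := g%:R.
Let budget_F : R := 3 * (Y / K%:R) * X ^+ 19.
Let F := Num.truncn budget_F.

Lemma scale_ge1000 : 1000 <= X. Proof. by rewrite ler_nat. Qed.

Lemma scale_gt0 : 0 < X. Proof. by have := scale_ge1000; lra. Qed.

Lemma unit_gt0 : 0 < Gr.
Proof.
by rewrite ltr0n; apply: leq_trans (unit_ge s_big n_big); apply: leq_trans s_big.
Qed.

Lemma order_gt0 : 0 < Y.
Proof.
rewrite ltr0n; apply: leq_trans n_big; rewrite expn_gt0; apply/orP; left.
exact: leq_trans s_big.
Qed.

Lemma order_le : Y <= 2 * Gr * X ^+ 26.
Proof. by rewrite -natrX -natrM -natrM ler_nat -mulnA unit_lt. Qed.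

Lemma offer_size_gt0 : 0 < K%:R :> R. Proof. by rewrite ltr0n. Qed.

Lemma budget_F_ge0 : 0 <= budget_F.
Proof.
by rewrite /budget_F !mulr_ge0 ?exprn_ge0.
Qed.

(** The successor in [F.+1] compensates the truncation of [budget_F]. *)
Lemma failures_le (E c : R) : E = Y / K%:R * c -> c * X <= 3 * X ^+ 19 -> E / F.+1%:R <= X^-1.
Proof.
move=> -> cX; rewrite ler_pdivrMr // [leRHS]mulrC ler_pdivlMr; last exact: scale_gt0.
apply: (le_trans _ (ltW (truncnS_gt budget_F))).
have -> : budget_F = Y / K%:R * (3 * X ^+ 19) by rewrite /budget_F; ring.
by rewrite -[leLHS]mulrA ler_wpM2l // divr_ge0.
Qed.

Lemma delta1_le : (n * n)%:R / 2 / K%:R / (g * s ^ 8)%:R / F.+1%:R <= X^-1.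
Proof.
have G0 := unit_gt0; have X0 := scale_gt0; have K0 := offer_size_gt0.
have P0 : 0 < 2 * (Gr * X ^+ 8) by rewrite !mulr_gt0 ?exprn_gt0.
apply: (@failures_le _ (Y / (2 * (Gr * X ^+ 8)))).
  rewrite !(natrX, natrM) -/Y -/X -/Gr; field.
  by rewrite !lt0r_neq0 ?exprn_gt0.
rewrite mulrAC ler_pdivrMr //; apply: le_trans (ler_wpM2r (ltW X0) order_le) _.
have -> : 2 * Gr * X ^+ 26 * X = 2 * Gr * X ^+ 27 by ring.
have -> : 3 * X ^+ 19 * (2 * (Gr * X ^+ 8)) = 2 * Gr * X ^+ 27 + 4 * Gr * X ^+ 27 by ring.
by rewrite lerDl !mulr_ge0 ?exprn_ge0.
Qed.

(** The factor [s ^ 8] gained by the legs is exactly the ratio of the two stopping points, so this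
    is the error of the greedy phase again. *)
Lemma delta2b_le : (n * n)%:R / 2 / (K * s ^ 8)%:R / g%:R / F.+1%:R <= X^-1.
Proof.
apply: le_trans delta1_le; rewrite le_eqVlt; apply/orP; left; apply/eqP; congr (_ / _).
have G0 := unit_gt0; have X0 := scale_gt0; have K0 := offer_size_gt0.
by rewrite !(natrX, natrM) -/Y -/X -/Gr; field; rewrite !lt0r_neq0 ?exprn_gt0.
Qed.

Lemma delta2a_le (q : nat) : (q <= 3 * (g * s ^ 16))%N ->
  q%:R * (n%:R / K%:R / g%:R) / F.+1%:R <= X^-1.
Proof.
move=> q_le; have G0 := unit_gt0; have X0 := scale_gt0; have K0 := offer_size_gt0.
apply: (@failures_le _ (q%:R / Gr)).
  by rewrite -/Y -/Gr; field; rewrite !lt0r_neq0.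
rewrite mulrAC ler_pdivrMr //.
apply: le_trans (_ : _ <= 3 * (Gr * X ^+ 16) * X) _.
  apply: ler_wpM2r; first exact: ltW.
  by move: q_le; rewrite -(ler_nat R) !(natrX, natrM).
have -> : 3 * X ^+ 19 * Gr = 3 * Gr * X ^+ 17 * X ^+ 2 by ring.
have -> : 3 * (Gr * X ^+ 16) * X = 3 * Gr * X ^+ 17 by ring.
rewrite ler_peMr ?mulr_ge0 ?exprn_ge0 // exprn_ege1 //.
by have := scale_ge1000; lra.
Qed.

Lemma delta3_le :
  (3 * (g * s ^ 24))%:R * ((n * n)%:R / 2 / (K * (g * s ^ 21) ^ 2)%:R) / F.+1%:R <= X^-1.
Proof.
have G0 := unit_gt0; have X0 := scale_gt0; have K0 := offer_size_gt0.
have P0 : 0 < 2 * (Gr * X ^+ 18) by rewrite !mulr_gt0 ?exprn_gt0.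
apply: (@failures_le _ (3 * Y / (2 * (Gr * X ^+ 18)))).
  rewrite !(natrX, natrM) -/Y -/X -/Gr; field.
  by rewrite !lt0r_neq0 ?exprn_gt0.
rewrite mulrAC ler_pdivrMr // mulrAC.
apply: le_trans (_ : _ <= 3 * X * (2 * Gr * X ^+ 26)) _.
  by rewrite ler_wpM2l ?order_le // mulr_ge0 // ltW.
have -> : 3 * X ^+ 19 * (2 * (Gr * X ^+ 18)) = 6 * Gr * X ^+ 27 * X ^+ 10 by ring.
have -> : 3 * X * (2 * Gr * X ^+ 26) = 6 * Gr * X ^+ 27 by ring.
rewrite ler_peMr ?mulr_ge0 ?exprn_ge0 // exprn_ege1 //.
by have := scale_ge1000; lra.
Qed.

Lemma delta5_le (H : R) : 0 <= H <= 1 + 2 * X ^+ 20 ->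
  (n * n)%:R / 2 / (K * (s ^ 9 * (4 * (g * s ^ 21))))%:R * H / F.+1%:R <= X^-1.
Proof.
move=> /andP[H0 H_le]; have G0 := unit_gt0; have X0 := scale_gt0; have K0 := offer_size_gt0.
have P0 : 0 < 8 * (Gr * X ^+ 30) by rewrite !mulr_gt0 ?exprn_gt0.
apply: (@failures_le _ (Y * H / (8 * (Gr * X ^+ 30)))).
  rewrite !(natrX, natrM) -/Y -/X -/Gr; field.
  by rewrite !lt0r_neq0 ?exprn_gt0.
rewrite mulrAC ler_pdivrMr // mulrAC.
apply: le_trans (_ : _ <= (2 * Gr * X ^+ 26) * X * (1 + 2 * X ^+ 20)) _.
  apply: ler_pM => //; first by rewrite mulr_ge0 // ltW // order_gt0.
  by rewrite ler_wpM2r ?order_le // ltW.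
have -> : 3 * X ^+ 19 * (8 * (Gr * X ^+ 30)) = (2 * Gr * X ^+ 26) * X * (12 * X ^+ 22) by ring.
rewrite ler_wpM2l ?mulr_ge0 ?exprn_ge0 //.
have X20 : 1 <= X ^+ 20 by rewrite exprn_ege1 //; have := scale_ge1000; lra.
have -> : X ^+ 22 = X ^+ 20 * X ^+ 2 by ring.
have X2 : 1 <= X ^+ 2 by rewrite exprn_ege1 //; have := scale_ge1000; lra.
have : X ^+ 20 <= X ^+ 20 * X ^+ 2 by rewrite ler_peMr // (le_trans ler01).
lra.
Qed.

(** Every [s ^ 2] added edges at least halve the mean number of unlinked pairs. With [N] the size of
    the reserve, [3 * N] halvings turn [4 ^ N] into [2 ^ -N]. *)
Lemma unlinked_le :
  (4 ^ (g * s ^ 22))%:R * (1 - ((g * s ^ 21) ^ 2)%:R / ((g * s ^ 22) ^ 2)%:R)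
     ^+ (3 * (g * s ^ 24)) <= X^-1 :> R.
Proof.
have G0 := unit_gt0; have X0 := scale_gt0.
have -> : ((g * s ^ 21) ^ 2)%:R / ((g * s ^ 22) ^ 2)%:R = (X ^+ 2)^-1 :> R.
  by rewrite !(natrX, natrM) -/X -/Gr; field; rewrite !lt0r_neq0.
pose N := (g * s ^ 22)%N.
have NE : (3 * (g * s ^ 24) = s ^ 2 * (3 * N))%N.
  by rewrite /N [RHS]mulnCA [(s ^ 2 * _)%N]mulnCA -expnD.
rewrite NE exprM.
have X2 : 1 <= X ^+ 2 by rewrite exprn_ege1 //; have := scale_ge1000; lra.
have b0 : 0 <= 1 - (X ^+ 2)^-1 by rewrite subr_ge0 invf_le1 // exprn_gt0.
have e1 : (1 - (X ^+ 2)^-1) ^+ (s ^ 2) <= 2^-1.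
  apply: le_trans (_ : _ <= expR (- (X ^+ 2)^-1) ^+ (s ^ 2)) _.
    by rewrite lerXn2r ?nnegrE ?expR_ge0 //; apply: expR_ge1Dx.
  rewrite -expRM_natl natrX -/X mulrN divff ?lt0r_neq0 ?exprn_gt0 // expRN.
  by rewrite lef_pV2 ?posrE ?expR_gt0 // expR1_ge2.
apply: le_trans (_ : _ <= (4 ^ N)%:R * (2^-1) ^+ (3 * N)) _.
  by rewrite ler_wpM2l // lerXn2r ?nnegrE // exprn_ge0.
rewrite exprM natrX -exprMn.
have -> : 4 * (2^-1) ^+ 3 = 2^-1 :> R by field.
rewrite exprVn lef_pV2 ?posrE ?exprn_gt0 // -natrX ler_nat.
apply: leq_trans (ltnW (ltn_expl N (ltnSn 1))).
rewrite /N; apply: leq_trans (leq_pmulr _ _); first exact: unit_ge.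
by rewrite expn_gt0 (leq_trans _ s_big).
Qed.

End Estimates.

Lemma exponent_arith (R : realFieldType) (p q t x : R) : q <= p -> 1 <= q -> x <= q -> t <= q ->
  1 + t - 50 * p <= - x.
Proof. by lra. Qed.

Lemma time_arith (R : realFieldType) (h p q z w v : R) : p <= z -> q <= w -> 0 <= w -> 0 <= z ->
  h + 5 * p + 5 * (3 * q) + (v + 50 * w + 50 * z) <= h + v + 125 * z + 125 * w.
Proof. by lra. Qed.

(** * Duration of the long leg phase and total time *)

Section Rates.
Variables (R : realType) (n s K : nat).
Hypotheses (s_big : (1000 <= s)%N) (n_big : (s ^ 27 <= n)%N) (K_gt0 : (0 < K)%N).
Let g := (n %/ s ^ 26)%N.
Let X : R := s%:R.
Let Y : R := n%:R.
Let Gr : R := g%:R.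
Let a : R := ln Y.
Let u : R := (ln a)^-1.
Hypotheses (a_ge : X ^+ 20 <= a) (a_le : a <= 2 * X ^+ 20).
Hypotheses (L_ge1 : 1 <= ln a) (L_le : ln a <= X).


Lemma inv_X_gt0 : 0 < X^-1. Proof. by rewrite invr_gt0 (scale_gt0 R s_big). Qed.

Lemma inv_X_le : X^-1 <= 1000^-1.
Proof.
rewrite lef_pV2; first exact: (scale_ge1000 R s_big).
- by rewrite posrE; exact: (scale_gt0 R s_big).
- by rewrite posrE ltr0n.
Qed.

Lemma u_gt0 : 0 < u. Proof. by rewrite invr_gt0 (lt_le_trans ltr01). Qed.

Lemma u_ge : X^-1 <= u.
Proof. by rewrite lef_pV2 ?posrE ?(scale_gt0 R s_big) // (lt_le_trans ltr01). Qed.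

Lemma u_le1 : u <= 1.
Proof. by rewrite invf_le1 // (lt_le_trans ltr01). Qed.

Lemma X_ge1 : 1 <= X. Proof. by apply: le_trans (scale_ge1000 R s_big); rewrite ler1n. Qed.

Lemma a_gt0 : 0 < a.
Proof. by apply: lt_le_trans a_ge; rewrite exprn_gt0 // (scale_gt0 R s_big). Qed.

Lemma u_ge0 : 0 <= u. Proof. exact: ltW u_gt0. Qed.
Lemma a_ge0 : 0 <= a. Proof. exact: ltW a_gt0. Qed.
Lemma X_ge0 : 0 <= X. Proof. exact: ler0n. Qed.

Local Ltac nonneg := repeat first
  [ exact: u_ge0 | exact: a_ge0 | exact: X_ge0 | exact: ler0n | assumption | apply: addr_ge0 | apply: mulr_ge0 | apply: exprn_ge0
  | rewrite invr_ge0 ].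

Lemma ua_ge : X ^+ 19 <= u * a.
Proof.
apply: le_trans (_ : _ <= X^-1 * X ^+ 20) _.
  by rewrite (exprS X 19) mulrA mulVf ?mul1r // lt0r_neq0 // (scale_gt0 R s_big).
by apply: ler_pM; [nonneg | nonneg | exact: u_ge | exact: a_ge].
Qed.

Lemma GX_le : Gr * X ^+ 26 <= Y.
Proof. by have := unit_le n s; rewrite -(ler_nat R) !(natrX, natrM). Qed.

Let attach_time : R := (1 + 100 * u) * (a * Y / (2 * K%:R)) + 50 * u * Y.
Let T4 := Num.truncn attach_time.

(** The two parts of [attach_time] pay for the two parts of the denominator: the term with [a] for
    [Y / 2], and [50 * u * Y] for [K%:R * m], which matters for large [K]. The loss of [2 / X] is
    absorbed because [u >= X^-1]. *)
Lemma rate_ge (m : R) : 0 <= m -> m <= 3 * Gr ->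
  (1 + 50 * u) * a <= (1 - 2 / X) * K%:R / (K%:R * m + Y / 2) * attach_time.
Proof.
move=> m0 m_le; have K0' := (offer_size_gt0 R K_gt0); have X0' := (scale_gt0 R s_big).
have D0 : 0 < K%:R * m + Y / 2.
  by apply: ltr_wpDl; [nonneg | rewrite divr_gt0 // (order_gt0 R s_big n_big)].
rewrite mulrAC ler_pdivlMr //.
have -> : (1 - 2 / X) * K%:R * attach_time =
    (1 - 2 / X) * (1 + 100 * u) * (a * Y / 2) + K%:R * ((1 - 2 / X) * (50 * u) * Y).
  by rewrite /attach_time; field; rewrite !lt0r_neq0.
have -> : (1 + 50 * u) * a * (K%:R * m + Y / 2) =
    (1 + 50 * u) * (a * Y / 2) + K%:R * ((1 + 50 * u) * a * m) by field.
have iX := inv_X_le; have iX0 := inv_X_gt0; have iu := u_ge; have u0 := u_gt0.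
apply: lerD.
  apply: ler_wpM2r; first by nonneg.
  by move: iX iX0 iu; move: (X^-1) => i iX iX0 iu; nra.
apply: ler_wpM2l; first by nonneg.
apply: le_trans (_ : _ <= 51 * (2 * X ^+ 20) * (3 * Gr)) _.
  apply: ler_pM; [by nonneg | exact: m0 | | exact: m_le].
  apply: ler_pM; [by nonneg | by nonneg | | exact: a_le].
  by have := u_le1; lra.
apply: le_trans (_ : _ <= 25 * X^-1 * (Gr * X ^+ 26)) _.
  have -> : 25 * X^-1 * (Gr * X ^+ 26) = Gr * X ^+ 20 * (25 * X ^+ 5).
    by field; rewrite lt0r_neq0.
  have -> : 51 * (2 * X ^+ 20) * (3 * Gr) = Gr * X ^+ 20 * 306 by ring.
  apply: ler_wpM2l; first by nonneg.
  have : X <= X ^+ 5 by rewrite exprS ler_peMr ?exprn_ege1 ?X_ge1 ?X_ge0.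
  by have := (scale_ge1000 R s_big); lra.
apply: ler_pM; [by nonneg | by nonneg | | exact: GX_le].
by move: iX iX0 iu; move: (X^-1) => i iX iX0 iu; nra.
Qed.

(** Here [theta] is [s]: [1 - theta^-1] costs only a factor [1 - 1 / s], while [theta ^ (s ^ 9)] is
    at most the exponential of [s ^ 10]. That is negligible against the surplus [50 * u * a], which
    is at least [50 * s ^ 19]. *)
Lemma delta4_le (m r : nat) : (0 < m)%N -> (m <= 3 * g)%N -> (m <= n)%N -> (s * r <= n)%N ->
  (1 - (K * (n - r))%:R * (1 - X^-1) / ((K * (m * n))%:R + (n * n)%:R / 2)) ^+ T4
    * (m%:R * X ^+ (s ^ 9)) <= X^-1.
Proof.
move=> m_gt0 m_le mn r_le; have Y0' := (order_gt0 R s_big n_big).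
have mR : m%:R <= 3 * Gr by rewrite -natrM ler_nat.
have iX := inv_X_le; have iX0 := inv_X_gt0.
have one_iX : 0 <= 1 - X^-1 by move: iX; move: (X^-1) => i; lra.
set kappa := (K * (n - r))%:R * _ / _.
have rn : (r <= n)%N by apply: leq_trans r_le; rewrite leq_pmull // (leq_trans _ s_big).
have avE : (1 - X^-1) * Y <= (n - r)%:R.
  rewrite natrB // mulrBl mul1r lerD2l lerN2 mulrC ler_pdivlMr ?(scale_gt0 R s_big) //.
  by rewrite mulrC -natrM ler_nat.
have D0 : 0 < K%:R * m%:R + Y / 2.
  by apply: ltr_wpDl; [nonneg | rewrite divr_gt0].
have kE : kappa = K%:R * ((n - r)%:R / Y * (1 - X^-1)) / (K%:R * m%:R + Y / 2).
  rewrite /kappa !natrM -/Y.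
  have -> : K%:R * (m%:R * Y) + Y * Y / 2 = Y * (K%:R * m%:R + Y / 2) by ring.
  by move: (_ + Y / 2) D0 => D D0; field; rewrite !lt0r_neq0 ?(scale_gt0 R s_big).
have k_ge : (1 - 2 / X) * K%:R / (K%:R * m%:R + Y / 2) <= kappa.
  rewrite kE; apply: ler_wpM2r; first by rewrite invr_ge0 ltW.
  rewrite mulrC; apply: ler_wpM2l; first by nonneg.
  apply: le_trans (_ : _ <= (1 - X^-1) * (1 - X^-1)) _.
    by move: (X^-1) => i; nra.
  by apply: ler_wpM2r; rewrite ?ler_pdivlMr.
have k_le1 : kappa <= 1.
  rewrite kE ler_pdivrMr // mul1r.
  apply: le_trans (_ : _ <= K%:R * m%:R) _; last by rewrite lerDl; nonneg.
  apply: ler_wpM2l; first by nonneg.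
  apply: le_trans (_ : _ <= 1) _; last by rewrite ler1n.
  rewrite -[leRHS](mulr1 1); apply: ler_pM; [by nonneg | exact: one_iX | |].
    by rewrite ler_pdivrMr // mul1r ler_nat leq_subr.
  by rewrite gerBl ltW.
have k_ge0 : 0 <= kappa.
  by rewrite kE; apply: mulr_ge0; [nonneg | rewrite invr_ge0 ltW].
(* The 1 covers the truncation of [attach_time], as [kappa <= 1]. *)
have kT : (1 + 50 * u) * a - 1 <= kappa * T4%:R.
  have h := rate_ge (ler0n _ _) mR.
  have x_le : attach_time - 1 <= T4%:R.
    by rewrite lerBlDr natr1 ltW // truncnS_gt.
  have at0 : 0 <= attach_time by rewrite /attach_time; nonneg.
  apply: le_trans (ler_wpM2l k_ge0 x_le).
  rewrite mulrBr mulr1; apply: lerB => //.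
  exact: le_trans h (ler_wpM2r at0 k_ge).
have e1 : (1 - kappa) ^+ T4 <= expR (1 - (1 + 50 * u) * a).
  apply: le_trans (_ : _ <= expR (- kappa) ^+ T4) _.
    by rewrite lerXn2r ?nnegrE ?expR_ge0 ?subr_ge0 //; apply: expR_ge1Dx.
  rewrite -expRM_natr ler_expR mulNr -[leRHS]opprB lerN2 //.
have e2 : m%:R <= expR a by rewrite lnK ?posrE // ler_nat.
have X_expR : X <= expR X by apply: le_trans (expR_ge1Dx X); rewrite lerDr.
have e3 : X ^+ (s ^ 9) <= expR (X ^+ 10).
  apply: le_trans (_ : _ <= expR X ^+ (s ^ 9)) _.
    by rewrite lerXn2r ?nnegrE ?expR_ge0 ?X_ge0.
  by rewrite -expRM_natl natrX -exprSr.
apply: le_trans (_ : _ <= expR (1 - (1 + 50 * u) * a) * (expR a * expR (X ^+ 10))) _.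
  apply: ler_pM => //; [by rewrite exprn_ge0 // subr_ge0 | by nonneg |].
  by apply: ler_pM => //; nonneg.
rewrite -!expRD; apply: le_trans (_ : _ <= expR (- X)) _; last first.
  by rewrite expRN lef_pV2 ?posrE ?expR_gt0 ?(scale_gt0 R s_big).
rewrite ler_expR.
have ua := ua_ge.
have -> : 1 - (1 + 50 * u) * a + (a + X ^+ 10) = 1 + X ^+ 10 - 50 * (u * a) by ring.
have x1 : 1 <= X ^+ 19 by rewrite exprn_ege1 // X_ge1.
have x2 : X <= X ^+ 19 by rewrite exprS ler_peMr ?exprn_ege1 ?X_ge1 ?X_ge0.
have x3 : X ^+ 10 <= X ^+ 19 by rewrite -[19%N]/(10 + 9)%N exprD ler_peMr ?exprn_ege1 ?exprn_ge0 ?X_ge1 ?X_ge0.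
exact: (@exponent_arith R (u * a) (X ^+ 19) (X ^+ 10) X).
Qed.

(** Expanding [rounds] leaves a surplus of [125 * u * Y] and of [125 * u * a * Y / K]. Of these at
    most 55 and 65 units are used: 50 of each by [attach_time], 5 by the extra edges and 15 by the
    wasted rounds. *)
Lemma time_le (q : nat) F : F%:R <= 3 * (Y / K%:R) * X ^+ 19 ->
  (q <= n./2 + 5 * (g * s ^ 24))%N ->
  (q + 5 * F + T4 <= Num.truncn (rounds R n K))%N.
Proof.
move=> F_le q_le; have Kn0 := lt0r_neq0 (offer_size_gt0 R K_gt0).
have at0 : 0 <= attach_time by rewrite /attach_time; nonneg.
have T4_le : T4%:R <= attach_time by rewrite truncn_le.
have rE : rounds R n K = (1 + 250 * u) * (Y / 2 + a * Y / (2 * K%:R)).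
  by rewrite /rounds -/Y -/a -/u; move: u => v; field.
have r0 : 0 <= rounds R n K by rewrite rE; nonneg.
rewrite truncn_ge_nat // (natrD _ (q + 5 * F)) (natrD _ q) natrM.
have q_le' : q%:R <= Y / 2 + 5 * (Y / X ^+ 2).
  apply: le_trans (_ : _ <= (n./2)%:R + 5 * (Gr * X ^+ 24)) _.
    by move: q_le; rewrite -(ler_nat R) natrD !(natrX, natrM).
  apply: lerD.
    by rewrite ler_pdivlMr // -natrM ler_nat muln2 -[leqRHS]odd_double_half leq_addl.
  apply: ler_wpM2l => //; rewrite ler_pdivlMr ?exprn_gt0 ?(scale_gt0 R s_big) //.
  by rewrite -mulrA -exprD; exact: GX_le.
rewrite rE.
apply: le_trans (_ : _ <= Y / 2 + 5 * (Y / X ^+ 2) + 5 * (3 * (Y / K%:R) * X ^+ 19) + attach_time) _.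
  by apply: lerD => //; apply: lerD => //; apply: ler_wpM2l.
have uY : Y / X ^+ 2 <= u * Y.
  rewrite mulrC; apply: ler_wpM2r; first by nonneg.
  apply: le_trans u_ge; rewrite lef_pV2 ?posrE ?exprn_gt0 ?(scale_gt0 R s_big) //.
  by rewrite expr2 ler_peMr ?X_ge1 ?X_ge0.
have uaY : Y / K%:R * X ^+ 19 <= u * (a * Y / K%:R).
  have -> : u * (a * Y / K%:R) = Y / K%:R * (u * a) by ring.
  by apply: ler_wpM2l; [nonneg | exact: ua_ge].
have -> : attach_time = (1 + 100 * u) * (a * Y / K%:R / 2) + 50 * u * Y.
  by rewrite /attach_time; field.
have -> : a * Y / (2 * K%:R) = a * Y / K%:R / 2 by field.
have z0 : 0 <= u * (a * Y / K%:R) by nonneg.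
have w0 : 0 <= u * Y by nonneg.
rewrite -(mulrA 3) -(mulrA 50).
have -> : (1 + 250 * u) * (Y / 2 + a * Y / K%:R / 2) =
   Y / 2 + a * Y / K%:R / 2 + 125 * (u * Y) + 125 * (u * (a * Y / K%:R)) by field.
have -> : (1 + 100 * u) * (a * Y / K%:R / 2) = a * Y / K%:R / 2 + 50 * (u * (a * Y / K%:R)).
  by field.
exact: time_arith.
Qed.

End Rates.

(** * The loss at a given scale *)

Section LossBound.
Variables (R : realType) (n s K : nat) (G : pred (graph n)).
Hypotheses (s_big : (1000 <= s)%N) (n_big : (s ^ 27 <= n)%N) (K_gt0 : (0 < K)%N).
Hypotheses (a_ge : s%:R ^+ 20 <= ln (n%:R : R)) (a_le : ln (n%:R : R) <= 2 * s%:R ^+ 20).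
Hypotheses (L_ge1 : 1 <= ln (ln (n%:R : R))) (L_le : ln (ln (n%:R : R)) <= s%:R).
Hypothesis goodG : forall B : graph n, (#|B|%:R <= budget R n) -> has_matching B n./2 -> G B.

Lemma expR_half_le2 : expR (2^-1 : R) <= 2.
Proof.
rewrite -[2^-1]opprK expRN invf_ple ?posrE ?expR_gt0 //.
by apply: le_trans (expR_ge1Dx _); lra.
Qed.

(** This justifies the doubling depth [(s ^ 21).-1] in the reserve: [n] is at most
    [2 ^ (4 * s ^ 20)], and [s ^ 21] leaves ample room. *)
Lemma n_le_pow2 : (n <= 2 ^ (s ^ 21).-1)%N.
Proof.
have n_pos := order_gt0 R s_big n_big.
rewrite -(ler_nat R) -(@lnK _ (n%:R : R)) ?posrE //.
apply: le_trans (_ : _ <= expR (2^-1) ^+ (4 * s ^ 20)) _.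
  rewrite -expRM_natr ler_expR; apply: le_trans a_le _.
  by rewrite natrM natrX; move: (s%:R ^+ 20) => x; lra.
apply: le_trans (_ : _ <= 2 ^+ (4 * s ^ 20)) _.
  by rewrite lerXn2r ?nnegrE ?expR_ge0 // expR_half_le2.
rewrite -natrX ler_nat leq_pexp2l //.
have := pow_gap s_big (isT : 20 < 21)%N; have : (0 < s ^ 20)%N.
  by rewrite expn_gt0 (leq_trans _ s_big).
by move: (s ^ 20)%N (s ^ 21)%N => x y; clear; lia.
Qed.

(** The extra edges number at most [5 * n / s^2], well below [11 * n / L] because [L <= s]. *)
Lemma budget_ge (B : graph n) : (#|B| <= n./2 + 5 * (n %/ s ^ 26 * s ^ 24))%N ->
  #|B|%:R <= budget R n.
Proof.
have X0 := scale_gt0 R s_big; have X1 := scale_ge1000 R s_big.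
rewrite -(ler_nat R) natrD => /le_trans; apply.
rewrite /budget mulrDl; apply: lerD.
  rewrite mulrC mulrA mulr1 ler_pdivlMr // -natrM ler_nat muln2.
  by rewrite -[leqRHS]odd_double_half leq_addl.
have := unit_le n s; rewrite -(ler_nat R) !(natrX, natrM) => GX.
have L0 : 0 < ln (ln (n%:R : R)) by apply: lt_le_trans L_ge1.
rewrite mulrAC ler_pdivlMr //.
apply: le_trans (_ : _ <= 5 * ((n %/ s ^ 26)%:R * s%:R ^+ 24) * s%:R) _.
  by apply: ler_wpM2l => //; rewrite !mulr_ge0 ?exprn_ge0.
apply: le_trans (_ : _ <= 5 * ((n %/ s ^ 26)%:R * s%:R ^+ 26)) _.
  have -> : 5 * ((n %/ s ^ 26)%:R * s%:R ^+ 24) * s%:R =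
    5 * ((n %/ s ^ 26)%:R * s%:R ^+ 25) :> R by ring.
  apply: ler_wpM2l => //; apply: ler_wpM2l => //.
  by apply: ler_weXn2l => //; apply: le_trans X1; rewrite ler1n.
apply: le_trans (_ : _ <= 5 * n%:R) _; first exact: ler_wpM2l.
by apply: ler_wpM2r => //; rewrite ler_nat.
Qed.

Lemma loss_bound :
  loss R K G (Num.truncn (rounds R n K)) (finset.set0 : graph n) <= 7 / s%:R.
Proof.
have [c10 c0n m0n Nn [Nk rr sr bb [q3 m3]]] := phase_sizes s_big n_big.
have s_gt0 : (0 < s)%N by apply: leq_trans s_big.
have g_gt0 : (0 < n %/ s ^ 26)%N by apply: leq_trans (unit_ge s_big n_big).
set g := (n %/ s ^ 26)%N in c10 c0n m0n Nn Nk rr sr bb q3 m3 g_gt0.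
set r := (_ + _ + 2 * (2 * _))%N in rr sr.
have d_gt0 : (0 < s ^ 9)%N by rewrite expn_gt0 s_gt0.
have d2_gt0 : (0 < s ^ 8)%N by rewrite expn_gt0 s_gt0.
have k_gt0 : (0 < g * s ^ 21)%N by rewrite muln_gt0 g_gt0 expn_gt0 s_gt0.
have mn : (2 * g + 1 <= n)%N by apply: leq_trans Nn; exact: leq_addl.
have m_gt0 : (0 < 2 * g + 1)%N by rewrite addn1.
have kl : (g * s ^ 21 <= 2 ^ (s ^ 21).-1)%N.
  apply: leq_trans n_le_pow2; apply: leq_trans (unit_le n s).
  by rewrite leq_mul2l leq_pexp2l // orbT.
have lE : (s ^ 21).-1.+1 = (s ^ 21)%N by rewrite prednK // expn_gt0 s_gt0.
have Nk' : (5 * (g * s ^ 21) + (2 * g + 1) * (s ^ 21).-1.+1 <= g * s ^ 22)%N.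
  by rewrite lE.
have X1 : 1 <= s%:R :> R by rewrite ler1n.
pose F := Num.truncn (3 * (n%:R / K%:R) * s%:R ^+ 19 : R).
pose T4 := Num.truncn ((1 + 100 * (ln (ln n%:R))^-1) * (ln n%:R * n%:R / (2 * K%:R))
  + 50 * (ln (ln n%:R))^-1 * n%:R : R).
pose q := (2 * g + 1 + 3 * (g * s ^ 24) + (g * s ^ 8 - g) + (2 * (g * s ^ 8) + 1) * s ^ 8
  + (n./2 - g * s ^ 8))%N.
apply: le_trans (_ : _ <= loss R K G (q + 5 * F + T4) finset.set0) _.
  apply: loss_mono; apply: (time_le s_big K_gt0 a_ge L_ge1 L_le).
  - by rewrite /F truncn_le; apply: budget_F_ge0.
  - apply: leq_trans bb; rewrite /q; move: (n./2 - _)%N (g * s ^ 8 - g)%N => x y.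
    by move: ((_ + 1) * s ^ 8)%N ((_ + 1) * s ^ 9)%N (3 * _)%N => z w v; clear; lia.
have := @all_phases_loss R n K G K_gt0 (g * s ^ 8)%N g (s ^ 8)%N (g * s ^ 22)%N (g * s ^ 21)%N
  (s ^ 21).-1 (s ^ 9)%N (3 * (g * s ^ 24))%N (n - r)%N (n./2 + 5 * (g * s ^ 24))%N F T4 s%:R
  g_gt0 d2_gt0 k_gt0 d_gt0 kl c10 c0n X1 m0n Nn rr Nk' bb.
have -> : (2 * g + 1 + F + T4 + 3 * (g * s ^ 24) + F + (g * s ^ 8 - g) + F
   + (2 * (g * s ^ 8) + 1) * s ^ 8 + F + (n./2 - g * s ^ 8) + F = q + 5 * F + T4)%N.
  rewrite /q; move: (n./2 - _)%N (g * s ^ 8 - g)%N ((_ + 1) * s ^ 8)%N (3 * _)%N F T4.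
  by clear; lia.
move=> /(_ (fun B hB => goodG (budget_ge hB)))/le_trans; apply.
(* Six error terms, of which the one for linking the reserve has two parts. *)
have -> : 7 / s%:R = s%:R^-1 + s%:R^-1 + (s%:R^-1 + s%:R^-1) + s%:R^-1 + s%:R^-1 + s%:R^-1 :> R.
  by move: (s%:R^-1) => x; ring.
apply: lerD; last exact: (delta1_le R s_big n_big K_gt0).
apply: lerD; last exact: (delta2a_le R s_big n_big K_gt0 q3).
apply: lerD; last exact: (delta2b_le R s_big n_big K_gt0).
apply: lerD; last first.
  by apply: lerD; [exact: (unlinked_le R s_big n_big) | exact: (delta3_le R s_big n_big K_gt0)].
apply: lerD; last exact: (delta4_le s_big n_big K_gt0 a_ge a_le L_ge1 L_le m_gt0 m3 mn sr).
apply: (delta5_le s_big n_big K_gt0).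
apply/andP; split; first by apply: sumr_ge0 => i _; rewrite invr_ge0.
apply: le_trans (harmonic_sum_le R _) _; first by rewrite addn1.
rewrite lerD2l; apply: le_trans a_le; rewrite ler_ln ?posrE ?ltr0n ?ler_nat //.
exact: leq_trans mn.
Qed.

End LossBound.

(** * Choice of the scale *)

Section Scale.
Variables (R : realType) (n : nat) (y0 : R).
Hypotheses (y0_big : 2000 <= y0) (n_big : expR (expR (20 * y0)) <= n%:R).

(* With [y = ln (ln n) / 20], so that [expR y ^+ 20 = ln n], the scale is
   [s = truncn (expR y)]. *)
Lemma scale_exists : exists s : nat, [/\ (1000 <= s)%N, (s ^ 27 <= n)%N, y0 <= s%:R &
  [/\ s%:R ^+ 20 <= ln (n%:R : R), ln (n%:R : R) <= 2 * s%:R ^+ 20,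
      1 <= ln (ln (n%:R : R)) & ln (ln (n%:R : R)) <= s%:R]].
Proof.
have nE : expR (ln (n%:R : R)) = n%:R.
  by apply: lnK; rewrite posrE; apply: lt_le_trans n_big; apply: expR_gt0.
have a_ge : expR (20 * y0) <= ln (n%:R : R) by rewrite -ler_expR nE.
move: nE a_ge; set a := ln (n%:R : R) => nE a_ge.
have aE : expR (ln a) = a.
  by apply: lnK; rewrite posrE; apply: lt_le_trans a_ge; apply: expR_gt0.
have L_ge : 20 * y0 <= ln a by rewrite -ler_expR aE.
move: aE L_ge; set L := ln a => aE L_ge.
pose y := L / 20.
have y_ge : y0 <= y by rewrite /y ler_pdivlMr // mulrC.
have yL : L = 20 * y by rewrite /y; field.
have y2000 : 2000 <= y by apply: le_trans y_ge.
(* Two terms of the series suffice: with [y >= 2000] they give [s >= 20 * y], which is [L], even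
   after truncation. *)
have e_ge : 1 + y ^+ 2 / 2 <= expR y.
  by have := @expR_ge1Dxn R y 1 (le_trans (ler0n _ _) y2000).
pose s := Num.truncn (expR y); pose X : R := s%:R.
have X_le : X <= expR y by rewrite truncn_le expR_ge0.
have X_lt : expR y < X + 1 by rewrite natr1 truncnS_gt.
have X_ge : 20 * y <= X.
  have arith (e x z : R) : 1 + z ^+ 2 / 2 <= e -> e < x + 1 -> 2000 <= z -> 20 * z <= x.
    by clear; nra.
  exact: arith e_ge X_lt y2000.
have aX : a = expR y ^+ 20 by rewrite -expRM_natl -yL aE.
have X_big : 1000 <= X.
  by apply: le_trans X_ge; lra.
have X0 : 0 < X by apply: lt_le_trans X_big; rewrite ltr0n.
exists s; split.
- by rewrite -(ler_nat R); exact: X_big.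
- rewrite -(ler_nat R) natrX -/X -nE.
  have a0 : 0 <= a by rewrite aX exprn_ge0 // expR_ge0.
  have e2 : 1 + a ^+ 2 / 2 <= expR a by have := @expR_ge1Dxn R a 1 a0.
  apply: le_trans e2.
  have Xa : X ^+ 20 <= a by rewrite aX lerXn2r ?nnegrE ?expR_ge0 // ltW.
  have Xa2 : X ^+ 40 <= a ^+ 2.
    by rewrite -[40%N]/(20 * 2)%N exprM lerXn2r ?nnegrE ?exprn_ge0 // ltW.
  have X1 : 1 <= X by apply: le_trans X_big; rewrite ler1n.
  have h : X ^+ 27 * 2 <= X ^+ 40.
    rewrite -[40%N]/(27 + 13)%N exprD ler_wpM2l ?exprn_ge0 ?(ltW X0) //.
    apply: le_trans (_ : _ <= X ^+ 1) _; first by apply: le_trans X_big; rewrite ler_nat.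
    by apply: ler_weXn2l.
  move: (le_trans h Xa2); move: (X ^+ 27) (a ^+ 2) => p q.
  by lra.
- by apply: le_trans X_ge; lra.
split.
- by rewrite aX lerXn2r ?nnegrE ?expR_ge0 // ltW.
- rewrite aX; apply: le_trans (_ : _ <= (X + 1) ^+ 20) _.
    by rewrite lerXn2r ?nnegrE ?expR_ge0 ?addr_ge0 ?(ltW X0) // ltW.
  have X10 : 0 < X + 1 by rewrite addr_gt0.
  have i01 : 0 <= (X + 1)^-1 <= 1.
    by rewrite invr_ge0 (ltW X10) invf_le1 // lerDr ltW.
  (* Truncation costs at most a factor 2 in the twentieth power: [(X / (X + 1)) ^ 20] is at least
     [1 - 20 / (X + 1)], hence at least one half. *)
  have := bernoulli_sub 20 i01.
  have -> : 1 - (X + 1)^-1 = X / (X + 1) by field; rewrite lt0r_neq0.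
  rewrite expr_div_n ler_pdivlMr ?exprn_gt0 // => h.
  have i40 : (X + 1)^-1 <= 40^-1.
    by rewrite lef_pV2 ?posrE //; lra.
  have : 2^-1 * (X + 1) ^+ 20 <= X ^+ 20.
    apply: le_trans h; rewrite ler_wpM2r ?exprn_ge0 ?(ltW X10) //.
    by lra.
  by move: ((X + 1) ^+ 20) (X ^+ 20) => p q; lra.
- by rewrite yL; lra.
- by rewrite yL.
Qed.

End Scale.

(** * Passage to the limit *)

Local Open Scope classical_set_scope.
Local Open Scope ring_scope.

Theorem theorem2 (R : realType) (K : nat -> nat) (K_gt0 : forall n : nat, (0 < K n)%N) :
  exists S : forall n : nat, strategy n,
    (forall n : nat, legal (S n)) /\
    (fun n : nat =>
       process_prob R (K n) (S n) (Num.truncn (rounds R n (K n)))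
         (fun B : graph n =>
            ((#|B|%:R : R) <= budget R n) && has_matching B n./2))
      @ \oo --> (1 : R).
Proof.
pose G n : pred (graph n) := fun B => ((#|B|%:R : R) <= budget R n) && has_matching B n./2.
exists (fun n => optimal R (K n) (G n) (Num.truncn (rounds R n (K n)))); split.
  by move=> n; apply: optimal_legal.
apply/cvgrPdist_le => e e0.
(* The scale will be at least [7 / e], so that the loss bound [7 / s] is at most [e]; 2000 is the
   threshold of [scale_exists]. *)
have y_big : 2000 <= 2000 + 7 / e by rewrite lerDl divr_ge0 // ltW.
near=> n.
have n_big : expR (expR (20 * (2000 + 7 / e))) <= n%:R.
  by near: n; exact: nbhs_infty_ger.
have [s [s_big sn ys [a_ge a_le L_ge L_le]]] := scale_exists y_big n_big.
rewrite (process_optimal R (K n) (G n)) opprB addrC subrK.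
rewrite ger0_norm ?loss_ge0 //.
apply: le_trans (loss_bound s_big sn (K_gt0 n) a_ge a_le L_ge L_le _) _.
  by move=> B Bb Bm; rewrite /G Bb.
have s0 : 0 < s%:R :> R by rewrite ltr0n (leq_trans _ s_big).
rewrite ler_pdivrMr // mulrC -ler_pdivrMr //.
by apply: le_trans ys; rewrite lerDr ler0n.
Unshelve. all: by end_near.
Qed.
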